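(* There exists a constant $C=C(d)>1$ such that for any Lévy process $Y$ in $\mathbb R^d$, any open set $D\subset\mathbb R^d$, any $z_0\in\partial D$ and any $r>0$, $$\mathbb E_x\big[\tau_{D\cap B(z_0,4r)}\big]\le C\,\mathbb E_x\big[\tau_{D\cap B(z_0,2r)}\big]\qquad\text{for all } x\in D\cap B(z_0,r).$$
   Context: $d\ge1$; $B(x,r)$ is the open Euclidean ball; $\mathbb P_x$, $\mathbb E_x$ refer to $Y$ started at $x$; $\tau_B:=\inf\{t\ge0:Y_t\notin B\}$ is the first exit time of $Y$ from $B$. *)

(* Defs.v *)
From HB Require Import structures.
From mathcomp Require Import all_boot all_order all_algebra.
From mathcomp Require Import all_classical all_reals all_analysis.

Set Implicit Arguments.
Unset Strict Implicit.
Unset Printing Implicit Defensive.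

Import Order.TTheory GRing.Theory Num.Theory.
Import numFieldNormedType.Exports.

Local Open Scope classical_set_scope.
Local Open Scope ring_scope.

(* The library norm on ['rV[R]_d] is the sup norm, hence these definitions;
   its topology is the usual one and is used for [open], [closure] and limits. *)
Definition enorm (R : realType) (d : nat) (x : 'rV[R]_d) : R :=
  Num.sqrt (\sum_(i < d) x ord0 i ^+ 2).

Definition eball (R : realType) (d : nat) (x : 'rV[R]_d) (r : R) :
    set 'rV[R]_d :=
  [set y | enorm (y - x) < r].

Definition boundary (T : topologicalType) (D : set T) : set T :=
  closure D `\` interior D.

Definition borel (R : realType) (d : nat) : set (set 'rV[R]_d) :=
  <<s @open 'rV[R]_d >>.
Arguments borel : clear implicits.

Definition random_vector (R : realType) (d : nat) (disp : measure_display)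
    (T : measurableType disp) (X : T -> 'rV[R]_d) : Prop :=
  forall A, borel R d A -> measurable (X @^-1` A).

Definition same_law (R : realType) (d : nat) (disp : measure_display)
    (T : measurableType disp) (P : probability T R) (X Z : T -> 'rV[R]_d) :
    Prop :=
  forall A, borel R d A -> P (X @^-1` A) = P (Z @^-1` A).

(* The product rule for subfamilies is the case where some [A i] are [setT]. *)
Definition independent (R : realType) (d : nat) (disp : measure_display)
    (T : measurableType disp) (P : probability T R) (n : nat)
    (X : 'I_n -> T -> 'rV[R]_d) : Prop :=
  forall A : 'I_n -> set 'rV[R]_d, (forall i, borel R d (A i)) ->
    P (\bigcap_i (X i @^-1` A i)) = (\prod_(i < n) P (X i @^-1` A i))%E.

Definition cadlag (R : realType) (d : nat) (f : R -> 'rV[R]_d) : Prop :=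
  (forall t : R, 0 <= t -> f s @[s --> t^'+] --> f t) /\
  (forall t : R, 0 < t -> exists l : 'rV[R]_d, f s @[s --> t^'-] --> l).

(* Only the values [Y t] with [0 <= t] are relevant. *)
Record levy_process (R : realType) (d : nat) (disp : measure_display)
    (T : measurableType disp) (P : probability T R)
    (Y : R -> T -> 'rV[R]_d) : Prop := LevyProcess {
  levy_measurable : forall t : R, 0 <= t -> random_vector (Y t);
  levy_start0 : {ae P, forall w, Y 0 w = 0};
  levy_independent : forall (n : nat) (t : nat -> R), 0 <= t 0%N ->
    (forall i, (i < n)%N -> t i <= t i.+1) ->
    independent P (fun (i : 'I_n) w => Y (t i.+1) w - Y (t i) w);
  levy_stationary : forall s t : R, 0 <= s -> 0 <= t ->
    same_law P (fun w => Y (s + t) w - Y s w) (fun w => Y t w - Y 0 w);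
  levy_stoch_continuous : forall t eps : R, 0 <= t -> 0 < eps ->
    P [set w | eps < enorm (Y s w - Y t w)]
      @[s --> within [set s | 0 <= s] (nbhs t)] --> 0%E;
  levy_cadlag : {ae P, forall w, cadlag (fun t => Y t w)} }.

Definition exit_time (R : realType) (d : nat) (f : R -> 'rV[R]_d)
    (B : set 'rV[R]_d) : \bar R :=
  ereal_inf [set t%:E | t in [set t | 0 <= t /\ ~ B (f t)]].

(* [E_x[tau_B]]: under [P_x] the process has the law of [x + Y] under [P].
   [\int] of a nonnegative function is the supremum of the integrals of the
   measurable simple functions below it, so when the exit time is measurable
   only for the [P]-completion this is its integral for the completed
   measure. *)
Definition mean_exit_time (R : realType) (d : nat) (disp : measure_display)
    (T : measurableType disp) (P : probability T R)
    (Y : R -> T -> 'rV[R]_d) (x : 'rV[R]_d) (B : set 'rV[R]_d) : \bar R :=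
  (\int[P]_w exit_time (fun t => (x + Y t w)%R) B)%E.

(* Main.v *)
Require Import Defs.
From HB Require Import structures.
From mathcomp Require Import all_boot all_order all_algebra.
From mathcomp Require Import ring lra.
From mathcomp Require Import all_classical all_reals all_analysis.
From mathcomp Require Import measurable_realfun.

Set Implicit Arguments.
Unset Strict Implicit.
Unset Printing Implicit Defensive.

Import Order.TTheory GRing.Theory Num.Theory.
Import numFieldNormedType.Exports.

Local Open Scope classical_set_scope.
Local Open Scope ring_scope.

(** Write [W t = Y t - Y 0], [U] and [V] for the intersections of [D] with the
balls of radius [2 r] and [4 r], and put [rho = r / 8]. If the path leaves [U]
at time [S] without leaving [V], it is then at distance at least [r] from its
starting point [x]. So the exit time from [V] exceeds [S] only on the event
that [W S] is large, and there, by the strong Markov property, the excess has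
mean at most the mean exit time from a ball of diameter [8 r]. The theorem
follows from two estimates with a common time scale [m].

- Leaving is expensive ([displacement_at_stopping]). If
  [P (|W s| >= rho) <= 1/16] for all [s <= m], then, for a stopping time [S],
  [m * P (|W S| >= 4 rho)] is at most a constant times the mean of [S]. The
  expected time [f y] that [y + W] spends outside the ball of radius [rho]
  between the times [0] and [m] is small at [y = 0] and almost [m] when [y] is
  far. Start the process at an almost minimiser [y] of [f]. Delaying the time
  window by [S] adds at most [S] to the time spent outside, so the mean of
  [f (y + W S)] is at most [f y] plus the mean of [S]. As [f] is almost minimal
  at [y] and close to [m] far away, [W S] is seldom large. No generator,
  characteristic exponent or symmetry is involved: visits are counted.

- Staying is expensive too ([prob_big_displacement], [confined_sum_le]). If
  [P (|W t| >= rho) > 1/16] for some [t <= 2 m], some coordinate of [W t] is at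
  least [rho / d] in one direction with probability at least [1 / (32 d)]. The
  same move made [64 d] times in a row carries the process over the distance
  [8 r], so the exit time from a set of diameter [8 r] has geometric tails at
  the time scale [64 d t <= 128 d m].

Doubling a scale until it stops satisfying the first condition produces [m] and
[t]; if that never happens, the first estimate with [m] arbitrarily large shows
that [W S] is almost surely never large. Both cases are combined in
[overshoot_bound].

The estimates are proved for stopping times with values in the grid of mesh
[2 ^ -k], where the past is generated by finitely many increments and the
strong Markov property is independence of increments ([past_independent]). They
are transferred to [U] by an exhaustion of [U] by the closed sets [shrink U n]:
the grid exit times from [shrink U n] decrease with [k] to a time below the exit
time from [U], and these times increase with [n] to some [T]. Almost surely the
path does not jump at [T] when approached in this way ([no_jump_at_limit]), as
the increment following a stopping time is small in probability uniformly in
the stopping time. Hence the path at [T] is out of [U], unless [T] is the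
finite horizon [L] up to which times are counted. Fatou's lemma in [k] and then
in [n] gives the result. Since the integral is a supremum over simple functions,
only measurable functions below the exit times occur: arbitrary bounded ones for
[V], and the limits of the grid exit times for [U]. *)

(** * Euclidean norm, Borel sets and random vectors *)

Section euclidean_norm.
Context {R : realType} {d : nat}.
Implicit Types x y z : 'rV[R]_d.

Lemma enorm_ge0 x : 0 <= enorm x.
Proof. exact: sqrtr_ge0. Qed.

Lemma sqr_enorm x : enorm x ^+ 2 = \sum_(i < d) x ord0 i ^+ 2.
Proof. by rewrite sqr_sqrtr// sumr_ge0// => i _; exact: sqr_ge0. Qed.

Lemma enorm0 : enorm (0 : 'rV[R]_d) = 0.
Proof. by rewrite /enorm big1 ?sqrtr0// => i _; rewrite mxE expr0n. Qed.

Lemma enormN x : enorm (- x) = enorm x.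
Proof. by congr Num.sqrt; apply: eq_bigr => i _; rewrite mxE sqrrN. Qed.

Lemma le_coord_enorm x i : `|x ord0 i| <= enorm x.
Proof.
rewrite -sqrtr_sqr ler_wsqrtr// (bigD1 i)//= lerDl sumr_ge0// => j _.
exact: sqr_ge0.
Qed.

(** The discriminant argument, with the quadratic form evaluated at
[(enorm y, enorm x)]. *)
Lemma cauchy_schwarz x y :
  \sum_(i < d) x ord0 i * y ord0 i <= enorm x * enorm y.
Proof.
have Q0 a b : 0 <= a ^+ 2 * enorm x ^+ 2 - 2 * (a * b) *
    (\sum_(i < d) x ord0 i * y ord0 i) + b ^+ 2 * enorm y ^+ 2.
  have -> : a ^+ 2 * enorm x ^+ 2 - 2 * (a * b) *
      (\sum_(i < d) x ord0 i * y ord0 i) + b ^+ 2 * enorm y ^+ 2 =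
      \sum_(i < d) (a * x ord0 i - b * y ord0 i) ^+ 2.
    rewrite !sqr_enorm !mulr_sumr -sumrB -big_split/=.
    by apply: eq_bigr => i _; ring.
  by apply: sumr_ge0 => i _; exact: sqr_ge0.
have [x0|x0] := eqVneq (enorm x) 0.
  rewrite x0 mul0r big1// => i _; have := le_coord_enorm x i.
  by rewrite x0 normr_le0 => /eqP ->; rewrite mul0r.
have [y0|y0] := eqVneq (enorm y) 0.
  rewrite y0 mulr0 big1// => i _; have := le_coord_enorm y i.
  by rewrite y0 normr_le0 => /eqP ->; rewrite mulr0.
have xy0 : 0 < enorm x * enorm y by rewrite mulr_gt0// lt0r ?x0 ?y0 enorm_ge0.
rewrite -(ler_pM2l xy0) -(ler_pM2l (ltr0n R 2)).
by have := Q0 (enorm y) (enorm x); lra.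
Qed.

Lemma ler_enormD x y : enorm (x + y) <= enorm x + enorm y.
Proof.
rewrite -(@ler_pXn2r _ 2)// ?nnegrE ?addr_ge0 ?enorm_ge0//.
rewrite sqr_enorm sqrrD !sqr_enorm.
have -> : \sum_(i < d) (x + y) ord0 i ^+ 2 = \sum_(i < d) x ord0 i ^+ 2 +
    (\sum_(i < d) x ord0 i * y ord0 i) *+ 2 + \sum_(i < d) y ord0 i ^+ 2.
  rewrite -sumrMnl -!big_split/=; apply: eq_bigr => i _.
  by rewrite mxE sqrrD.
by rewrite lerD2r lerD2l lerMn2r/= cauchy_schwarz.
Qed.

Lemma ler_enormB x y : enorm x - enorm y <= enorm (x - y).
Proof. by rewrite lerBlDr (le_trans _ (ler_enormD _ _))// subrK. Qed.

Lemma enorm_le_sum x : enorm x <= \sum_(i < d) `|x ord0 i|.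
Proof.
have s0 : 0 <= \sum_(i < d) `|x ord0 i| by exact: sumr_ge0.
rewrite -(@ler_pXn2r _ 2)// ?nnegrE ?enorm_ge0// sqr_enorm expr2 mulr_suml.
apply: ler_sum => i _; rewrite -real_normK ?num_real// expr2 ler_wpM2l//.
by rewrite (bigD1 i)//= lerDl sumr_ge0.
Qed.

Lemma ball_enorm_le x y e : ball x e y -> enorm (x - y) <= d%:R * e.
Proof.
move=> [e0 xy]; rewrite (le_trans (enorm_le_sum _))//.
rewrite (@le_trans _ _ (\sum_(i < d) e))//; last first.
  by rewrite sumr_const card_ord mulr_natl.
by apply: ler_sum => i _; rewrite !mxE; apply/ltW/xy.
Qed.

Lemma enorm_lt_ball x y e : enorm (x - y) < e -> ball x e y.
Proof.
move=> xy; split=> [|i j]; first exact: le_lt_trans (enorm_ge0 _) xy.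
rewrite ord1 /ball/=; apply: le_lt_trans xy.
by have := le_coord_enorm (x - y) j; rewrite !mxE.
Qed.

(** The topology comes from the sup norm, which is at most the Euclidean norm
and at least its [d]-th part. *)
Lemma nbhs_enormP x (A : set 'rV[R]_d) :
  nbhs x A <-> exists2 e, 0 < e & forall y, enorm (x - y) < e -> A y.
Proof.
split=> [/nbhs_ballP[e /= e0 eA]|[e e0 eA]].
  by exists e => // y xy; apply: eA; exact: enorm_lt_ball.
apply/nbhs_ballP; exists (e / d.+1%:R) => /=; first by rewrite divr_gt0.
move=> y xy; apply: eA; rewrite (le_lt_trans (ball_enorm_le xy))//.
rewrite mulrCA -[ltRHS]mulr1 ltr_pM2l// ltr_pdivrMr// mul1r.
by rewrite ltr_nat.
Qed.

Lemma enorm_shift_continuous y : continuous (fun x => enorm (x + y)).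
Proof.
move=> x A /nbhs_ballP[e /= e0 eA]; apply/nbhs_enormP; exists e => // z xz.
apply: eA; rewrite /ball/= ltr_norml; apply/andP; split.
  rewrite ltrNl opprB (le_lt_trans (ler_enormB _ _))//.
  by rewrite opprD addrACA subrr addr0 -enormN opprB.
by rewrite (le_lt_trans (ler_enormB _ _))// opprD addrACA subrr addr0.
Qed.

End euclidean_norm.

Section borel_sets.
Context {R : realType} {d : nat}.
Implicit Types x y z : 'rV[R]_d.

Lemma borel_open (A : set 'rV[R]_d) : open A -> borel R d A.
Proof. exact: sub_gen_smallest. Qed.

Lemma borelC (A : set 'rV[R]_d) : borel R d A -> borel R d (~` A).
Proof. by rewrite -setTD; exact: sigma_algebraCD. Qed.

Lemma borel_setT : borel R d setT.
Proof. by apply: borel_open; exact: openT. Qed.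

Lemma borel_enorm_lt y r : borel R d [set x | enorm (x + y) < r].
Proof.
apply: borel_open; have /continuousP := @enorm_shift_continuous R d y.
by move=> /(_ [set u : R | u < r]); apply; exact: open_lt.
Qed.

Lemma borel_enorm_ge y r : borel R d [set x | r <= enorm (x + y)].
Proof.
rewrite (_ : mkset _ = ~` [set x | enorm (x + y) < r]).
  by apply: borelC; exact: borel_enorm_lt.
by apply/seteqP; split=> x /=; rewrite leNgt => /negP.
Qed.

Lemma borel_coord_lt i r : borel R d [set x | x ord0 i < r].
Proof.
apply: borel_open; have /continuousP := @coord_continuous R 1 d ord0 i.
by move=> /(_ [set u : R | u < r]); apply; exact: open_lt.
Qed.

Lemma borel_coord_gt i r : borel R d [set x | r < x ord0 i].
Proof.
apply: borel_open; have /continuousP := @coord_continuous R 1 d ord0 i.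
by move=> /(_ [set u : R | u > r]); apply; exact: open_gt.
Qed.

End borel_sets.

Section random_vectors.
Context {R : realType} {d : nat}.

(** The Borel sets are generated by the coordinates: an open set is the union
of the balls with rational centre and radius [1 / n] that it contains. *)
Lemma random_vectorP (disp : measure_display) (T : measurableType disp)
    (X : T -> 'rV[R]_d) :
  random_vector X <->
  forall i, measurable_fun setT (fun w => X w ord0 i).
Proof.
split=> [mX i|mX].
  apply: (measurability _ (RGenOInfty.measurableE R)) => _ [_ [r ->] <-].
  rewrite setTI; apply: (mX [set x | x ord0 i \in `]r, +oo[]).
  rewrite (_ : mkset _ = [set x | r < x ord0 i]); first exact: borel_coord_gt.
  by apply/seteqP; split=> x /=; rewrite in_itv/= andbT.
suff opn O : open O -> measurable (X @^-1` O).
  move=> A bA; pose XB : T -> g_sigma_algebraType (@open 'rV[R]_d) := X.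
  have mXB : measurable_fun setT XB.
    apply: (@measurability _ _ T (g_sigma_algebraType (@open 'rV[R]_d)) setT
      XB (@open 'rV[R]_d) erefl) => _ [B oB <-].
    by rewrite setTI; exact: opn.
  by rewrite -[X in measurable X]setTI; exact: mXB.
move=> oO; pose q (c : 'rV[rat]_d * nat) : set 'rV[R]_d :=
  ball (map_mx ratr c.1 : 'rV[R]_d) c.2.+1%:R^-1.
have -> : X @^-1` O = \bigcup_(c in [set c | q c `<=` O]) (X @^-1` (q c)).
  rewrite -preimage_bigcup; congr (_ @^-1` _); apply/seteqP; split=> [x Ox|x].
    have /nbhs_ballP[e /= e0 eO] := open_nbhs_nbhs (conj oO Ox).
    have [n ne] : exists n, n.+1%:R^-1 < e / 2 :> R.
      have := near_infty_natSinv_lt (PosNum (divr_gt0 e0 (ltr0n R 2))).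
      by move=> [N _ /(_ N (leqnn N))]; exists N.
    have h i : exists p : rat, ratr p \in `]x ord0 i - n.+1%:R^-1,
        x ord0 i + n.+1%:R^-1[.
      apply: rat_in_itvoo; rewrite ltrD2l (@lt_trans _ _ 0)// ?oppr_lt0//.
    have [p hp] := choice h.
    have pc : ball (map_mx ratr (\row_i p i) : 'rV[R]_d) n.+1%:R^-1 x.
      split => // i j; rewrite !mxE (_ : i = ord0); last exact: ord1.
      have := hp j; rewrite in_itv/= => /andP[l1 l2].
      by rewrite /ball/= ltr_distl l1 l2.
    exists (\row_i p i, n) => //= y py; apply: eO.
    have -> : e = e / 2 + e / 2 by lra.
    apply: ball_triangle (_ : ball _ _ (map_mx ratr (\row_i p i) : 'rV[R]_d)) _.
      by apply/ball_sym; apply: le_ball pc; exact: ltW.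
    by apply: le_ball py; exact: ltW.
  by move=> [c cO cx]; exact: cO cx.
rewrite bigcup_mkcond; apply: countable_bigcupT_measurable => [|c].
  exact: countableP.
case: ifP => // _.
have -> : X @^-1` (q c) = \bigcap_(i in [set: 'I_d])
   ((fun w => X w ord0 i) @^-1` (ball (ratr (c.1 ord0 i) : R) c.2.+1%:R^-1)).
  apply/seteqP; split=> w /=.
    by move=> [_ cw] i _; have := cw ord0 i; rewrite mxE.
  by move=> h; split => // i j; rewrite ord1 mxE; exact: h.
apply: fin_bigcap_measurable => [|i _]; first exact: finite_finset.
rewrite -[X in measurable X]setTI; apply: mX => //.
by apply: open_measurable; exact: ball_open.
Qed.

Lemma random_vectorD (disp : measure_display) (T : measurableType disp)
    (X Z : T -> 'rV[R]_d) : random_vector X -> random_vector Z ->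
  random_vector (fun w => X w + Z w).
Proof.
move=> /random_vectorP mX /random_vectorP mZ; apply/random_vectorP => i.
by under eq_fun do rewrite mxE; exact: measurable_funD.
Qed.

Lemma random_vectorB (disp : measure_display) (T : measurableType disp)
    (X Z : T -> 'rV[R]_d) : random_vector X -> random_vector Z ->
  random_vector (fun w => X w - Z w).
Proof.
move=> /random_vectorP mX /random_vectorP mZ; apply/random_vectorP => i.
by under eq_fun do rewrite !mxE; exact: measurable_funB.
Qed.

Lemma random_vector_cst (disp : measure_display) (T : measurableType disp)
    (x : 'rV[R]_d) : random_vector (fun _ : T => x).
Proof. by apply/random_vectorP => i; exact: measurable_cst. Qed.

End random_vectors.

(** * Independence and freezing of an independent variable *)

Section independence.
Context {R : realType} {disp : measure_display} {T : measurableType disp}.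
Variable P : probability T R.
Local Open Scope ereal_scope.

Lemma g_sigma_algebra_measurable (G : set (set T)) (E : set T) :
  G `<=` measurable -> <<s G >> E -> measurable E.
Proof.
move=> mG; by apply: smallest_sub => //; exact: sigma_algebra_measurable.
Qed.

(** The events independent of [F] form a Dynkin system. *)
Lemma pi_system_independent (G : set (set T)) (F : set T) :
  setI_closed G -> G `<=` measurable -> measurable F ->
  (forall E, G E -> P (E `&` F) = P E * P F) ->
  forall E, <<s G >> E -> P (E `&` F) = P E * P F.
Proof.
move=> GI mG mF GF E.
suff : <<s G >> `<=` [set E | measurable E /\ P (E `&` F) = P E * P F].
  by move=> h /h[].
have fP A : measurable A -> P A \is a fin_num by exact: fin_num_measure.
apply: lambda_system_subset => //; last by move=> A GA; split; [exact: mG|exact: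
    GF].
apply/dynkin_lambda_system; split => /=.
- by split => //; rewrite setTI probability_setT mul1e.
- move=> A [mA AF]; split; first exact: measurableC.
  rewrite setIC -setDE measureD//; last by rewrite -ge0_fin_numE// fP.
    rewrite probability_setC// [F `&` A]setIC.
  rewrite [X in _ - X](_ : _ = P A * P F); last exact: AF.
  by rewrite muleBl ?mul1e ?fin_num_adde_defr// fP.
- move=> B tB BF; split; first by apply: bigcupT_measurable => i; case: (BF i).
  rewrite setI_bigcupl measure_semi_bigcup//; last 3 first.
  - by move=> i; apply: measurableI => //; case: (BF i).
  - by under eq_fun do rewrite setIC; exact: trivIset_setIl.
  - by apply: bigcupT_measurable => i; apply: measurableI => //; case: (BF i).
  rewrite measure_semi_bigcup//; last 2 first.
  - by move=> i; case: (BF i).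
  - by apply: bigcupT_measurable => i; case: (BF i).
  rewrite [RHS]muleC -(fineK (fP _ mF)) -nneseriesZl//.
  by apply: eq_eseriesr => i _; rewrite (fineK (fP _ mF)) muleC; case: (BF i).
Qed.

End independence.

Section freezing.
Context {R : realType} {d1 d2 : measure_display}.
Context {T1 : measurableType d1} {T2 : measurableType d2}.
Context {disp : measure_display} {T : measurableType disp}.
Variables (P : probability T R) (E : set T) (mE : measurable E).
Variable U : {mfun T >-> T1}.
Local Open Scope ereal_scope.

(** The restriction to [E] carries the information about the past other than
the position [U], so that Fubini is only needed for a pair. *)
Let lawU := pushforward (mrestr P mE) U.

Let lawU0 : lawU set0 = 0.
Proof. exact: measure0. Qed.

Let lawU_ge0 B : 0 <= lawU B.
Proof. exact: measure_ge0. Qed.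

Let lawU_sigma_additive : semi_sigma_additive lawU.
Proof. exact: measure_semi_sigma_additive. Qed.

HB.instance Definition _ := isMeasure.Build _ _ _ lawU
  lawU0 lawU_ge0 lawU_sigma_additive.

Let lawU_finite : fin_num_fun lawU.
Proof.
move=> B mB; rewrite /lawU /pushforward /mrestr; apply: fin_num_measure.
by apply: measurableI => //; exact: measurable_funPTI.
Qed.

HB.instance Definition _ := Measure_isFinite.Build _ _ _ lawU lawU_finite.

(** Independence makes the law of [(U, V)] on [E] a product measure, so [U] can
be integrated out last. *)
Lemma freezing (V : {mfun T >-> T2}) (A : set (T1 * T2)) : measurable A ->
  (forall B C, measurable B -> measurable C ->
    P (E `&` U @^-1` B `&` V @^-1` C) = P (E `&` U @^-1` B) * P (V @^-1` C)) ->
  P (E `&` [set w | A (U w, V w)]) =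
  \int[lawU]_z P (V @^-1` xsection A z).
Proof.
move=> mA UV.
pose UVf w := (U w, V w).
have mUV : measurable_fun setT UVf by exact/measurable_fun_pair.
pose UVm : {mfun T >-> (T1 * T2)%type} :=
  HB.pack UVf (isMeasurableFun.Build _ _ _ _ _ mUV).
transitivity (pushforward (mrestr P mE) UVm A).
  by rewrite /pushforward/= /mrestr setIC.
rewrite -(@product_measure_unique _ _ _ _ _ lawU (distribution P V))//.
move=> B C mB mC.
transitivity (P (E `&` U @^-1` B `&` V @^-1` C)).
  rewrite [LHS](_ : _ = P (UVf @^-1` (B `*` C) `&` E))//; congr (P _).
  by apply/seteqP; split => w /=; tauto.
by rewrite UV// setIC.
Qed.

(** The form in which the Markov property is used to bound expected occupation
times from below: all the [V j] are seen from the same frozen position. *)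
Lemma freezing_sum_ge (n : nat) (V : 'I_n -> {mfun T >-> T2})
    (A : set (T1 * T2)) (B : set T1) (c : R) :
  measurable A -> measurable B -> E `<=` U @^-1` B -> (0 <= c)%R ->
  (forall j B C, measurable B -> measurable C ->
    P (E `&` U @^-1` B `&` V j @^-1` C) =
    P (E `&` U @^-1` B) * P (V j @^-1` C)) ->
  (forall z, B z -> c%:E <= \sum_(j < n) P (V j @^-1` xsection A z)) ->
  c%:E * P E <= \sum_(j < n) P (E `&` [set w | A (U w, V j w)]).
Proof.
move=> mA mB EB c0 UV cV.
have msec j : measurable_fun setT (fun z => P (V j @^-1` xsection A z)).
  exact: (@measurable_fun_xsection _ _ _ _ _ (distribution P (V j))).
rewrite (eq_bigr (fun j => \int[lawU]_z P (V j @^-1` xsection A z)))//; last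
    first.
  by move=> j _; apply: freezing => //; exact: UV.
rewrite -ge0_integral_sum//.
have -> : P E = lawU B.
  rewrite /lawU /pushforward /mrestr; congr (P _).
  by apply/seteqP; split => w /=; [move=> Ew; split => //; exact: EB|case].
rewrite -integral_cst//.
rewrite [leRHS](_ : _ = \int[lawU]_(z in setT) \sum_(j < n) P (V j @^-1`
    xsection A z))//.
apply: (@le_trans _ _ (\int[lawU]_(z in B) \sum_(j < n) P (V j @^-1` xsection A
    z))).
  apply: ge0_le_integral => //.
  by apply: measurable_funTS; exact: emeasurable_sum.
apply: ge0_subset_integral => //; first exact: emeasurable_sum.
by move=> z _; exact: sume_ge0.
Qed.

End freezing.

(** * Increments and the past of a Levy process on a grid *)

Section levy_increments.
Context {R : realType} {d : nat} {disp : measure_display}.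
Context {T : measurableType disp} (P : probability T R).
Variable Y : R -> T -> 'rV[R]_d.
Hypothesis levyY : levy_process P Y.

Definition displacement (t : R) (w : T) : 'rV[R]_d := Y t w - Y 0 w.

Definition increment (s t : R) (w : T) : 'rV[R]_d := Y (s + t) w - Y s w.

Local Notation W := displacement.

Lemma displacement0 w : W 0 w = 0.
Proof. exact: subrr. Qed.

Lemma displacementD s t w : W (s + t) w = W s w + increment s t w.
Proof. by rewrite /displacement /increment [RHS]addrC addrA subrK. Qed.

Lemma random_vector_displacement t : 0 <= t -> random_vector (W t).
Proof.
by move=> t0; apply: random_vectorB; apply: (levy_measurable levyY).
Qed.

Lemma random_vector_increment s t : 0 <= s -> 0 <= t ->
  random_vector (increment s t).
Proof.
move=> s0 t0; apply: random_vectorB; apply: (levy_measurable levyY) => //.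
exact: addr_ge0.
Qed.

Lemma law_increment s t A : 0 <= s -> 0 <= t -> borel R d A ->
  P (increment s t @^-1` A) = P (W t @^-1` A).
Proof. by move=> s0 t0; exact: (levy_stationary levyY). Qed.

Definition grid_cylinder (h : R) (n : nat) : set (set T) :=
  [set E | exists2 A : nat -> set 'rV[R]_d, (forall l, borel R d (A l)) &
     E = \bigcap_(l in `I_n) (increment (h * l%:R) h @^-1` A l)].

(** The sigma-algebra of the process on the grid [0, h, ..., n h]. A record
    keeps
it from being unfolded to a quantification over sigma-algebras. *)
Record past (h : R) (n : nat) (E : set T) : Prop := Past {
  past_generated : <<s grid_cylinder h n >> E }.

Section grid.
Variables (h : R) (h0 : 0 <= h).
Let hn0 n : 0 <= h * n%:R. Proof. by rewrite mulr_ge0. Qed.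

Lemma measurable_grid_cylinder n : grid_cylinder h n `<=` measurable.
Proof.
move=> _ [A bA ->]; apply: fin_bigcap_measurable => [|l _].
  exact: finite_II.
exact: random_vector_increment.
Qed.

Lemma measurable_past n E : past h n E -> measurable E.
Proof.
by move=> [pE]; exact: (g_sigma_algebra_measurable (@measurable_grid_cylinder
    n)).
Qed.

Lemma grid_cylinder_setI n : setI_closed (grid_cylinder h n).
Proof.
move=> _ _ [A bA ->] [B bB ->]; exists (fun l => A l `&` B l) => [l|].
  exact: (@measurableI _ (g_sigma_algebraType (@open 'rV[R]_d)) _ _ (bA l) (bB
      l)).
by rewrite -bigcapI; apply: eq_bigcapr => l _; rewrite preimage_setI.
Qed.

(** The displacement at a grid time is a sum of grid increments, and addition
is measurable on the sigma-algebra that these generate. *)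
Lemma grid_cylinder_displacement n l : (l <= n)%N ->
  forall A, borel R d A -> past h n (W (h * l%:R) @^-1` A).
Proof.
pose Tn := g_sigma_algebraType (grid_cylinder h n).
suff mW : (l <= n)%N -> random_vector (W (h * l%:R) : Tn -> _).
  by move=> ln A bA; split; exact: mW.
elim: l => [_|l IH ln].
  rewrite (_ : W _ = fun=> 0); first exact: (@random_vector_cst _ _ _ Tn).
  by apply/funext => w; rewrite mulr0 displacement0.
rewrite (_ : W _ = fun w => W (h * l%:R) w + increment (h * l%:R) h w).
  apply: random_vectorD; first by apply: IH; exact: ltnW.
  move=> A bA; apply: sub_sigma_algebra.
  exists (fun j => if j == l then A else setT) => [j|].
    by case: ifP => // _; exact: borel_setT.
  apply/seteqP; split => w /=.
    move=> Aw j _; rewrite /preimage/=; case: eqP => // ->; exact: Aw.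
  by move=> /(_ l ln)/=; rewrite eqxx.
by apply/funext => w; rewrite -natr1 mulrDr mulr1 displacementD.
Qed.

Lemma past_setT n : past h n setT.
Proof.
by split; exact: (@measurableT _ (g_sigma_algebraType (grid_cylinder h n))).
Qed.

Lemma past_setC n E : past h n E -> past h n (~` E).
Proof.
move=> [pE]; split.
exact: (@measurableC _ (g_sigma_algebraType (grid_cylinder h n))).
Qed.

Lemma past_setI n E F : past h n E -> past h n F -> past h n (E `&` F).
Proof.
move=> [pE] [pF]; split.
exact: (@measurableI _ (g_sigma_algebraType (grid_cylinder h n))).
Qed.

Lemma past_bigcap n m (F : nat -> set T) :
  (forall l, (l < m)%N -> past h n (F l)) ->
  past h n (\bigcap_(l in `I_m) F l).
Proof.
move=> mF; split.
apply: (@fin_bigcap_measurable _ (g_sigma_algebraType (grid_cylinder h n))).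
  exact: finite_II.
by move=> l /mF[].
Qed.

(** Independence of increments at the times [0, h, ..., n h] followed by
[n h + t, ..., n h + m t], together with stationarity. *)
Lemma cylinder_law n m (t : R) (A B : nat -> set 'rV[R]_d) : 0 <= t ->
  (forall l, borel R d (A l)) -> (forall l, borel R d (B l)) ->
  P (\bigcap_(l in `I_n) (increment (h * l%:R) h @^-1` A l) `&`
     \bigcap_(j in `I_m) (increment (h * n%:R + t * j%:R) t @^-1` B j)) =
  (\prod_(0 <= l < n) P (W h @^-1` A l) *
   \prod_(0 <= j < m) P (W t @^-1` B j))%E.
Proof.
move=> t0 bA bB.
pose tm k := if (k <= n)%N then h * k%:R else h * n%:R + t * (k - n)%:R.
pose C k := if (k < n)%N then A k else B (k - n)%N.
pose X k w := Y (tm k.+1) w - Y (tm k) w.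
have XA k : (k < n)%N -> X k = increment (h * k%:R) h.
  move=> kn; apply/funext => w.
  by rewrite /X /tm kn (ltnW kn) /increment -natr1 mulrDr mulr1.
have XB k : (n <= k)%N -> X k = increment (h * n%:R + t * (k - n)%:R) t.
  move=> nk; apply/funext => w.
  rewrite /X /tm ltnNge nk/= subSn// /increment -natr1 mulrDr mulr1 addrA.
  case: ifP => // kn; have -> : k = n by apply/eqP; rewrite eqn_leq kn nk.
  by rewrite subnn mulr0 addr0.
have := levy_independent levyY (n := n + m) (t := tm).
rewrite {1}/tm leq0n mulr0 lexx => /(_ isT).
have tmle i : (i < n + m)%N -> tm i <= tm i.+1.
  move=> _; rewrite /tm; case: ltnP => ni.
    by rewrite (ltnW ni) ler_wpM2l// ler_nat.
  case: ifP => [in_|_].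
    have -> : i = n by apply/eqP; rewrite eqn_leq in_ ni.
    by rewrite lerDl mulr_ge0.
  by rewrite lerD2l ler_wpM2l// ler_nat leq_sub2r.
have bC i : borel R d (C i) by rewrite /C; case: ifP.
move=> /(_ tmle) /(_ (fun i => C i) (fun i => bC i)) jointC.
transitivity (P (\bigcap_(i in [set: 'I_(n + m)]) (X i @^-1` C i))).
  congr (P _); apply/seteqP; split => w.
    move=> [wA wB] i _; have [ni|ni] := ltnP i n.
      by rewrite /C ni XA//; exact: wA.
    rewrite /C ltnNge ni/= XB//; apply: wB => /=.
    by rewrite ltn_subLR.
  move=> wC; split => l /= lnm.
    by have := wC (Ordinal (ltn_addr m lnm)) I; rewrite /C/= lnm XA.
  have nlm : (n + l < n + m)%N by rewrite ltn_add2l.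
  have := wC (Ordinal nlm) I.
  by rewrite /C/= ltnNge leq_addr/= XB ?leq_addr// addKn.
rewrite jointC -(big_mkord xpredT (fun i => P (X i @^-1` C i))).
rewrite (@big_cat_nat _ _ _ n) ?leq_addr//=; congr (_ * _)%E.
  rewrite !big_nat; apply: eq_bigr => i /= i_n.
  by rewrite /C i_n XA// law_increment.
rewrite -{1}(add0n n) big_addn addKn !big_nat; apply: eq_bigr => i _.
rewrite /C ltnNge leq_addl/= XB ?leq_addl// addnK law_increment//.
by rewrite addr_ge0// mulr_ge0.
Qed.

(** The Markov property at the grid time [n h]; cylinders are a pi-system
generating the past. *)
Lemma past_independent n m (t : R) (B : nat -> set 'rV[R]_d) E : 0 <= t ->
  (forall l, borel R d (B l)) -> past h n E ->
  P (E `&`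
     \bigcap_(j in `I_m) (increment (h * n%:R + t * j%:R) t @^-1` B j)) =
  (P E * \prod_(0 <= j < m) P (W t @^-1` B j))%E.
Proof.
move=> t0 bB [pE].
set F := \bigcap_(j in `I_m) _.
have bT := @borel_setT R d.
have PF : P F = (\prod_(0 <= j < m) P (W t @^-1` B j))%E.
  have := cylinder_law n m (A := fun=> setT) t0 (fun=> bT) bB.
  rewrite [X in X `&` _](_ : _ = setT); last first.
    by apply/seteqP; split => // w _ l _; rewrite preimage_setT.
  rewrite setTI => ->; rewrite [X in (X * _)%E]big1 ?mul1e// => l _.
  by rewrite preimage_setT; exact: probability_setT.
rewrite -PF.
apply: (pi_system_independent (@grid_cylinder_setI n)) pE => //.
- exact: measurable_grid_cylinder.
- apply: fin_bigcap_measurable => [|l _]; first exact: finite_II.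
  by apply: random_vector_increment => //; rewrite addr_ge0// mulr_ge0.
move=> _ [A bA ->].
rewrite cylinder_law//.
rewrite PF; congr (_ * _)%E.
have := cylinder_law n 0 t0 bA bB.
by rewrite II0 bigcap_set0 setIT [X in (_ * X)%E]big_geq// mule1 => ->.
Qed.

Lemma past_independent1 n (t : R) B E : 0 <= t -> borel R d B -> past h n E ->
  P (E `&` increment (h * n%:R) t @^-1` B) = (P E * P (W t @^-1` B))%E.
Proof.
move=> t0 bB pE; have := past_independent 1 t0 (fun=> bB) pE.
rewrite big_nat1 II1 bigcap_set1 mulr0 addr0; exact.
Qed.

End grid.

End levy_increments.

(** * Real-valued probabilities *)

Section real_probability.
Context {R : realType} {disp : measure_display} {T : measurableType disp}.
Variable P : probability T R.
Implicit Types A B : set T.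

Definition prob A : R := fine (P A).

Lemma probE A : measurable A -> P A = (prob A)%:E.
Proof. by move=> mA; rewrite fineK// fin_num_measure. Qed.

Lemma prob_ge0 A : 0 <= prob A.
Proof. exact: fine_ge0. Qed.

Lemma prob_le1 A : measurable A -> prob A <= 1.
Proof. by move=> mA; rewrite -lee_fin -probE// probability_le1. Qed.

Lemma prob_setT : prob setT = 1.
Proof. by rewrite /prob probability_setT. Qed.

Lemma le_prob A B : measurable A -> measurable B -> A `<=` B ->
  prob A <= prob B.
Proof.
by move=> mA mB AB; rewrite -lee_fin -!probE// le_measure ?inE.
Qed.

Lemma prob_setIC A B : measurable A -> measurable B ->
  prob A = prob (A `&` B) + prob (A `&` ~` B).
Proof.
move=> mA mB; apply: EFin_inj; rewrite EFinD -!probE//; last 2 first.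
- by apply: measurableI => //; exact: measurableC.
- exact: measurableI.
rewrite -measureU//; first by rewrite -setIUr setUv setIT.
- exact: measurableI.
- by apply: measurableI => //; exact: measurableC.
- by rewrite setIACA setICr setI0.
Qed.

Lemma prob_setC A : measurable A -> prob (~` A) = 1 - prob A.
Proof.
move=> mA; have := prob_setIC (@measurableT _ T) mA.
by rewrite !setTI prob_setT => ->; ring.
Qed.

Lemma prob_le_sum (J : finType) A (F : J -> set T) : measurable A ->
  (forall i, measurable (F i)) -> A `<=` \bigcup_i F i ->
  prob A <= \sum_i prob (F i).
Proof.
move=> mA mF AF.
suff cover (s : seq J) B : measurable B -> (forall w, B w -> exists2 i, i \in s
    & F i w) ->
    prob B <= \sum_(i <- s) prob (F i).
  by apply: cover => // w /AF[i _ Fi]; exists i => //; rewrite mem_index_enum.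
elim: s B => [|i s IH] B mB BF.
  rewrite big_nil (_ : B = set0); first by rewrite /prob measure0.
  by apply/seteqP; split => w // /BF[].
rewrite big_cons (prob_setIC mB (mF i)) lerD//.
  by apply: le_prob => //; exact: measurableI.
apply: IH; first by apply: measurableI => //; exact: measurableC.
move=> w [/BF[j]]; rewrite inE => /orP[/eqP -> //|js] Fj _; by exists j.
Qed.

Lemma prob_level_sum (N : T -> nat) n A :
  (forall i, measurable [set w | N w = i]) -> measurable A ->
  (forall w, (N w < n)%N) ->
  \sum_(i < n) prob ([set w | N w = i] `&` A) = prob A.
Proof.
move=> mN mA Nn.
have mNlt k : measurable [set w | (N w < k)%N].
  rewrite (_ : mkset _ = \bigcup_(i in `I_k) [set w | N w = i]).
    by apply: fin_bigcup_measurable => // i _; exact: mN.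
  by apply/seteqP; split => w /=; [exists (N w)|case=> i /= ik ->].
have -> : prob A = prob ([set w | (N w < n)%N] `&` A).
  by congr prob; apply/seteqP; split => w /=; [split|case].
elim: n {Nn} => [|n IH].
  rewrite big_ord0 (_ : mkset _ = set0); first by rewrite set0I /prob measure0.
  by apply/seteqP; split.
rewrite big_ord_recr/= IH.
have mS := measurableI _ _ (mNlt n.+1) mA.
rewrite (prob_setIC mS (mNlt n)); congr (prob _ + prob _); apply/seteqP; split
    => w /=.
- by move=> [? ?]; split => //; split => //; exact: leqW.
- by move=> [[_ ?] ?].
- by move=> [-> Aw]; rewrite ltnS leqnn ltnn.
- by move=> [[+ Aw] /negP]; rewrite ltnS -leqNgt => a b; split => //; apply/eqP;
    rewrite eqn_leq a b.
Qed.

End real_probability.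

(** * Displacement at a stopping time *)

Lemma borel_enorm_ge0 (R : realType) (d : nat) (r : R) :
  borel R d [set x | r <= enorm x].
Proof.
by have := borel_enorm_ge (0 : 'rV[R]_d) r; under eq_set do rewrite addr0.
Qed.

Lemma borel_enorm_lt0 (R : realType) (d : nat) (r : R) :
  borel R d [set x | enorm x < r].
Proof.
by have := borel_enorm_lt (0 : 'rV[R]_d) r; under eq_set do rewrite addr0.
Qed.

Lemma borel_enorm_gt0 (R : realType) (d : nat) (r : R) :
  borel R d [set x | r < enorm x].
Proof.
apply: borel_open; have /continuousP := @enorm_shift_continuous R d 0.
move=> /(_ [set u : R | u > r] (@open_gt R r)).
by rewrite /preimage; under eq_set do rewrite addr0.
Qed.

(** Shifting a window of length [n] by [i] changes at most [i] of its terms. *)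
Lemma window_sum_le (R : realType) (a : nat -> R) (c : R) n i :
  (forall l, 0 <= a l) -> (forall l, a l <= c) ->
  \sum_(j < n) a (i + j)%N <= \sum_(j < n) a j + i%:R * c.
Proof.
move=> a0 ac; elim: i => [|i IH]; first by rewrite mul0r addr0.
have : \sum_(j < n) a (i.+1 + j)%N <= \sum_(j < n) a (i + j)%N + c.
  have e : a i + \sum_(j < n) a (i.+1 + j)%N = \sum_(j < n) a (i + j)%N + a (i +
      n)%N.
    rewrite -(big_ord_recr n (fun j => a (i + j)%N)) big_ord_recl/= addn0.
    by congr +%R; apply: eq_bigr => j _; rewrite /bump/= addnA addn1.
  by have := a0 i; have := ac (i + n)%N; lra.
by rewrite -natr1 mulrDl mul1r; lra.
Qed.

Section displacement_bound.
Context {R : realType} {d : nat} {disp : measure_display}.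
Context {T : measurableType disp} (P : probability T R).
Variable Y : R -> T -> 'rV[R]_d.
Hypothesis levyY : levy_process P Y.
Local Notation W := (displacement Y).
Local Notation prob := (prob P).
Local Notation vec := (g_sigma_algebraType (@open 'rV[R]_d)).

Variables (h : R) (h0 : 0 <= h).
Let hn0 n : 0 <= h * n%:R. Proof. by rewrite mulr_ge0. Qed.

Let far (rho : R) (y : 'rV[R]_d) (l : nat) : set T :=
  [set w | rho <= enorm (y + W (h * l%:R) w)].

Let mfar rho y l : measurable (far rho y l).
Proof.
have := random_vector_displacement levyY (hn0 l) (borel_enorm_ge y rho).
by rewrite /far; under eq_set do rewrite addrC.
Qed.

(** The expected number of the first [n] grid times that the process started
at [y] spends outside the ball of radius [rho]. *)
Let occupation (rho : R) (n : nat) (y : 'rV[R]_d) : R :=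
  \sum_(j < n) prob (far rho y j).

(** Markov property for occupation times. *)
Lemma occupation_past rho n y i (E : set T) (B : set 'rV[R]_d) c :
  past Y h i E -> borel R d B -> E `<=` W (h * i%:R) @^-1` B -> 0 <= c ->
  (forall z, B z -> c <= occupation rho n (y + z)) ->
  c * prob E <= \sum_(j < n) prob (E `&` far rho y (i + j)%N).
Proof.
move=> pE bB EB c0 cB.
have mE := measurable_past levyY h0 pE.
have mW t : 0 <= t -> measurable_fun setT (W t : T -> vec).
  by move=> t0 _ A mA; rewrite setTI; exact: (random_vector_displacement levyY).
have mI s t : 0 <= s -> 0 <= t -> measurable_fun setT (increment Y s t : T ->
    vec).
  by move=> s0 t0 _ A mA; rewrite setTI; exact: (random_vector_increment levyY).
pose U : {mfun T >-> vec} :=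
  HB.pack (W (h * i%:R) : T -> vec) (isMeasurableFun.Build _ _ _ _ _ (mW _ (hn0
      i))).
pose V (j : 'I_n) : {mfun T >-> vec} :=
  HB.pack (increment Y (h * i%:R) (h * j%:R) : T -> vec)
    (isMeasurableFun.Build _ _ _ _ _ (mI _ _ (hn0 i) (hn0 j))).
pose A : set (vec * vec) := [set p | rho <= enorm ((p.1 + p.2 : 'rV[R]_d) + y)].
have mA : measurable A.
  have r1 : random_vector (fst : vec * vec -> 'rV[R]_d).
    by move=> C mC; rewrite -[X in measurable X]setTI; exact: measurable_fst.
  have r2 : random_vector (snd : vec * vec -> 'rV[R]_d).
    by move=> C mC; rewrite -[X in measurable X]setTI; exact: measurable_snd.
  exact: (random_vectorD r1 r2 (borel_enorm_ge y rho)).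
have farE j : far rho y (i + j)%N =
    [set w | A (W (h * i%:R) w, increment Y (h * i%:R) (h * j%:R) w)].
  by apply/seteqP; split => w; rewrite /far /A/= natrD mulrDr displacementD
      addrC.
have := @freezing_sum_ge R _ _ vec vec _ T P E mE U n V A B c mA bB EB c0.
have indep (j : 'I_n) B' C : borel R d B' -> borel R d C ->
    P (E `&` U @^-1` B' `&` V j @^-1` C) =
    (P (E `&` U @^-1` B') * P (V j @^-1` C))%E.
  move=> bB' bC; rewrite (law_increment levyY)//; apply: past_independent1 =>
      //.
  by apply: past_setI => //; exact: grid_cylinder_displacement.
move=> /(_ indep) freeze.
rewrite -lee_fin EFinM -sumEFin -probE//.
rewrite [leRHS](_ : _ =
  (\sum_(j < n) P (E `&` [set w | A (U w, V j w)]))%E); last first.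
  apply: eq_bigr => j _; rewrite -probE; first by rewrite farE.
  exact: measurableI.
apply: freeze => z Bz.
rewrite (_ : (\sum_(j < n) _)%E = (occupation rho n (y + z))%:E).
  by rewrite lee_fin cB.
rewrite /occupation -sumEFin; apply: eq_bigr => j _; rewrite -probE//.
rewrite (law_increment levyY)//; last exact: (measurable_xsection z mA).
have shift w : y + z + W (h * j%:R) w = z + W (h * j%:R) w + y.
  by rewrite -addrA [RHS]addrC.
by congr (P _); apply/seteqP; split => w;
  rewrite /xsection /far /preimage/= inE /A/= shift.
Qed.

Variables (rho : R) (n : nat) (n0 : (0 < n)%N).
Hypothesis near_origin :
  forall j, (j < n)%N -> prob (far rho 0 j) <= 16^-1.

Let occupation_far y : 2 * rho <= enorm y ->
  15 / 16 * n%:R <= occupation rho n y.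
Proof.
move=> yfar; rewrite /occupation.
rewrite (@le_trans _ _ (\sum_(j < n) (15 / 16 : R)))//.
  by rewrite sumr_const card_ord mulr_natr.
apply: ler_sum => j _.
have -> : 15 / 16 = 1 - 16^-1 :> R by lra.
rewrite (@le_trans _ _ (1 - prob (far rho 0 j)))//.
  by rewrite lerD2l lerN2 near_origin.
rewrite -prob_setC//; apply: le_prob => //; first exact: measurableC.
move=> w /=; rewrite /far/= add0r => /negP; rewrite -ltNge => Wlt.
have := ler_enormB y (- W (h * j%:R) w); rewrite opprK enormN.
by lra.
Qed.

Let occupation_ge0 y : 0 <= occupation rho n y.
Proof. by apply: sumr_ge0 => j _; exact: prob_ge0. Qed.

Let occupation_origin : occupation rho n 0 <= 16^-1 * n%:R.
Proof.
rewrite (@le_trans _ _ (\sum_(j < n) (16^-1 : R)))//.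
  by apply: ler_sum => j _; exact: near_origin.
by rewrite sumr_const card_ord mulr_natr.
Qed.

Variables (m : nat) (N : T -> nat).
Hypotheses (NI : forall w, (N w < m)%N)
  (pastN : forall i, past Y h i [set w | N w = i]).

(** Let [y] almost minimise the occupation function. By the Markov property the
time spent outside the ball during the window of [n] steps after [N], started at
[y], has mean at least [15/16 n] times the probability that [W] is far at [N],
plus the minimum times the probability of the complement. On the other hand it
exceeds the time spent outside during the first [n] steps by at most [N]. *)
Lemma displacement_at_stopping :
  7 / 8 * n%:R * prob [set w | 4 * rho <= enorm (W (h * (N w)%:R) w)] <=
  \sum_(i < m) i%:R * prob [set w | N w = i].
Proof.
have mN i : measurable [set w | N w = i] by exact: (measurable_past levyY h0
    (pastN i)).
pose c := inf (range (occupation rho n)).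
have hlb : has_lbound (range (occupation rho n)).
  by exists 0 => _ [y _ <-]; exact: occupation_ge0.
have hinf : has_inf (range (occupation rho n)).
  by split => //; exists (occupation rho n 0), 0.
have c_le y : c <= occupation rho n y.
  by apply: ge_inf => //; exists y.
have c0 : 0 <= c.
  by apply: lb_le_inf => //; [exists (occupation rho n 0), 0|
    move=> _ [y _ <-]; exact: occupation_ge0].
have nR0 : 0 < n%:R :> R by rewrite ltr0n.
apply/ler_addgt0Pr => e' e'0.
(* An error below [n / 16] keeps the value at [y] under the value far away. *)
pose e := Num.min e' (n%:R / 16).
have e0 : 0 < e by rewrite lt_min e'0 divr_gt0.
have [_ [y _ <-] yc] := inf_adherent e0 hinf.
have y2 : enorm y <= 2 * rho.
  rewrite leNgt; apply/negP => /ltW/occupation_far.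
  have := c_le 0; have := occupation_origin.
  have : e <= n%:R / 16 by rewrite ge_min lexx orbT.
  by rewrite -/c in yc; lra.
pose B := [set x : 'rV[R]_d | 4 * rho <= enorm x].
have bB : borel R d B by exact: borel_enorm_ge0.
pose Win i := [set w | N w = i] `&` ~` (W (h * i%:R) @^-1` B).
pose Wout i := [set w | N w = i] `&` (W (h * i%:R) @^-1` B).
have pB i : past Y h i (W (h * i%:R) @^-1` B) by exact:
    grid_cylinder_displacement.
have pBC i : past Y h i (~` (W (h * i%:R) @^-1` B)).
  by apply: past_setC; exact: pB.
have mB i := measurable_past levyY h0 (pB i).
have lower i : c * prob (Win i) + 15 / 16 * n%:R * prob (Wout i) <=
    \sum_(j < n) prob ([set w | N w = i] `&` far rho y (i + j)%N).
  apply: (@le_trans _ _ (\sum_(j < n) (prob (Win i `&` far rho y (i + j)%N) +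
    prob (Wout i `&` far rho y (i + j)%N)))); last first.
    apply: ler_sum => j _; rewrite addrC.
    rewrite [leRHS](@prob_setIC _ _ _ _ _ (W (h * i%:R) @^-1` B))//; last exact:
        measurableI.
    by rewrite /Win /Wout ![_ `&` far _ _ _ `&` _]setIAC.
  rewrite big_split/= lerD//.
    apply: (@occupation_past _ _ _ _ _ setT) => //.
    - exact: past_setI.
    - exact: borel_setT.
  apply: (@occupation_past _ _ _ _ _ B) => //.
  - exact: past_setI.
  - by move=> w [].
  - move=> z Bz; apply: occupation_far.
    have := ler_enormB z (- y); rewrite opprK enormN [z + y]addrC.
    by have : 4 * rho <= enorm z := Bz; lra.
have upper i : \sum_(j < n) prob ([set w | N w = i] `&` far rho y (i + j)%N) <=
    \sum_(j < n) prob ([set w | N w = i] `&` far rho y j) + i%:R * prob [set w |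
        N w = i].
  apply: (window_sum_le (a := fun l => prob ([set w | N w = i] `&` far rho y
      l))).
    by move=> l; exact: prob_ge0.
  by move=> l; apply: le_prob => //; exact: measurableI.
have : \sum_(i < m) (c * prob (Win i) + 15 / 16 * n%:R * prob (Wout i)) <=
    occupation rho n y + \sum_(i < m) i%:R * prob [set w | N w = i].
  have -> : occupation rho n y =
      \sum_(i < m) \sum_(j < n) prob ([set w | N w = i] `&` far rho y j).
    rewrite exchange_big/=; apply: eq_bigr => j _.
    by rewrite prob_level_sum.
  rewrite -big_split/=; apply: ler_sum => i _.
  exact: le_trans (lower i) (upper i).
rewrite big_split/= -!mulr_sumr.
pose F := [set w | 4 * rho <= enorm (W (h * (N w)%:R) w)].
have mF : measurable F.
  rewrite (_ : F = \bigcup_(i in [set: nat]) Wout i).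
    by apply: bigcupT_measurable => i; exact: measurableI.
  by apply/seteqP; split => [w Fw|w [i _ [/= <-]]//]; exists (N w).
have -> : \sum_(i < m) prob (Wout i) = prob F.
  rewrite -(prob_level_sum P mN mF NI); apply: eq_bigr => i _.
  by congr prob; apply/seteqP; split => w /= [<-].
have -> : \sum_(i < m) prob (Win i) = 1 - prob F.
  rewrite -prob_setC// -(prob_level_sum P mN (measurableC mF) NI).
  apply: eq_bigr => i _.
  by congr prob; apply/seteqP; split => w /= [<-].
set ES := \sum_(i < m) _.
have F0 := prob_ge0 P F; have F1 := prob_le1 P mF.
have c16 := le_trans (c_le 0) occupation_origin.
have ee' : e <= e' by rewrite ge_min lexx.
have cF : c * prob F <= 16^-1 * n%:R * prob F by rewrite ler_wpM2r.
rewrite -/c in yc; rewrite -/F.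
lra.
Qed.

End displacement_bound.

(** * Large displacements and confinement *)

Section big_displacement.
Context {R : realType} {d : nat} {disp : measure_display}.
Context {T : measurableType disp} (P : probability T R).
Variable Y : R -> T -> 'rV[R]_d.
Hypothesis levyY : levy_process P Y.
Local Notation W := (displacement Y).
Local Notation prob := (prob P).

Lemma measurable_displacement_ge t rho : 0 <= t ->
  measurable [set w | rho <= enorm (W t w)].
Proof.
move=> t0.
exact: (random_vector_displacement levyY t0 (@borel_enorm_ge0 R d rho)).
Qed.

(** The second component of [c] is the sign of the direction. *)
Let half_space (rho : R) (c : 'I_d * bool) : set 'rV[R]_d :=
  [set x | rho <= (-1) ^+ c.2 * x ord0 c.1].

Let borel_half_space rho c : borel R d (half_space rho c).
Proof.
case: c => i [].
  have -> : half_space rho (i, true) = ~` [set x : 'rV[R]_d | - rho < x ord0 i].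
    apply/seteqP; split => x; rewrite /half_space/= expr1 mulN1r lerNr leNgt.
      by move/negP.
    by move/negP.
  by apply: borelC; exact: borel_coord_gt.
have -> : half_space rho (i, false) = ~` [set x : 'rV[R]_d | x ord0 i < rho].
  apply/seteqP; split => x; rewrite /half_space/= expr0 mul1r leNgt.
    by move/negP.
  by move/negP.
by apply: borelC; exact: borel_coord_lt.
Qed.

(** One of the [2 d] signed coordinate directions gets its share of the
probability. *)
Lemma exists_half_space t rho : (0 < d)%N -> 0 <= t ->
  16^-1 < prob [set w | rho <= enorm (W t w)] ->
  exists c, (32 * d%:R)^-1 <= prob (W t @^-1` half_space (rho / d%:R) c).
Proof.
move=> d0 t0 Wt; have dR0 : 0 < d%:R :> R by rewrite ltr0n.
have mH c : measurable (W t @^-1` half_space (rho / d%:R) c).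
  exact: (random_vector_displacement levyY t0 (borel_half_space _ _)).
apply: contrapT => noc; move: Wt; apply/negP; rewrite -leNgt.
have -> : 16^-1 = \sum_(c : 'I_d * bool) (32 * d%:R)^-1 :> R.
  rewrite sumr_const card_prod card_ord card_bool -[RHS]mulr_natr natrM.
  by field; rewrite gt_eqF.
apply: (@le_trans _ _ (\sum_c prob (W t @^-1` half_space (rho / d%:R) c))).
  apply: prob_le_sum => //; first exact: measurable_displacement_ge.
  move=> w /= far.
  apply: contrapT => nocover.
  suff : enorm (W t w) < rho by rewrite ltNge far.
  rewrite (le_lt_trans (enorm_le_sum _))//.
  have -> : rho = \sum_(i < d) rho / d%:R.
    by rewrite sumr_const card_ord -[RHS]mulr_natr divfK// gt_eqF.
  apply: ltr_sum => [|i _].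
    by apply/hasP; exists (Ordinal d0) => //; rewrite mem_index_enum.
  rewrite ltr_norml; apply/andP; split; rewrite ltNge; apply/negP => h.
    apply: nocover; exists (i, true) => //.
    by rewrite /half_space /preimage/= expr1 mulN1r lerNr.
  apply: nocover; exists (i, false) => //.
  by rewrite /half_space /preimage/= expr0 mul1r.
apply: ler_sum => c _; rewrite leNgt; apply/negP => h; apply: noc.
by exists c; exact: ltW.
Qed.

(** A displacement of size [rho] has a coordinate of size [rho / d]; repeating
the same coordinate move [k] times adds up. *)
Lemma prob_big_displacement t rho k : (0 < d)%N -> 0 <= t ->
  16^-1 < prob [set w | rho <= enorm (W t w)] ->
  (32 * d%:R)^-1 ^+ k <=
    prob [set w | k%:R * (rho / d%:R) <= enorm (W (t * k%:R) w)].
Proof.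
move=> d0 t0 /(exists_half_space d0 t0)[c hc].
set H := half_space _ _ in hc.
have bH : borel R d H by exact: borel_half_space.
have tk0 j : 0 <= t * j%:R by rewrite mulr_ge0.
have mF : measurable (\bigcap_(j in `I_k) (increment Y (t * 0%:R + t * j%:R) t
    @^-1` H)).
  apply: fin_bigcap_measurable => [|j _]; first exact: finite_II.
  by apply: (random_vector_increment levyY) => //; rewrite addr_ge0.
have := past_independent levyY t0 k t0 (fun=> bH) (past_setT Y t 0).
rewrite setTI [P setT]probability_setT mul1e.
have -> : (\prod_(0 <= j < k) P (W t @^-1` H))%E = (prob (W t @^-1` H) ^+ k)%:E.
  elim: k {mF} => [|k IH]; first by rewrite big_geq.
  rewrite big_nat_recr//= IH exprSr EFinM -probE//.
  exact: (random_vector_displacement levyY).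
move=> PF.
apply: (@le_trans _ _ (prob (W t @^-1` H) ^+ k)).
  by apply: lerXn2r; rewrite ?nnegrE ?prob_ge0// invr_ge0 mulr_ge0.
rewrite -lee_fin -PF -probE; last exact: measurable_displacement_ge.
apply: le_measure; rewrite ?inE//; first exact: measurable_displacement_ge.
move=> w inH /=; apply: le_trans (le_coord_enorm _ c.1).
suff : k%:R * (rho / d%:R) <= (-1) ^+ c.2 * W (t * k%:R) w ord0 c.1.
  move=> /le_trans; apply; rewrite (le_trans (ler_norm _))//.
  by rewrite normrM normrX normrN1 expr1n mul1r.
elim: k {PF mF} inH => [|k IH] inH.
  by rewrite mulr0 displacement0 mxE mulr0 mul0r.
rewrite -[in t * _]natr1 mulrDr mulr1 displacementD mxE mulrDr -natr1 mulrDl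
    mul1r.
rewrite lerD//; first by apply: IH => j jk; apply: inH; exact: ltnW.
by have := inH k (ltnSn k); rewrite /preimage/= mulr0 add0r.
Qed.

(** The increments are independent of the past and of each other, so the [q]-th
term is at most [prob E * (1 - c) ^+ q], and the geometric series is summed. *)
Lemma confined_sum_le (h : R) n E t L c Q : 0 <= h -> past Y h n E -> 0 <= t ->
  0 < c -> c <= prob [set w | L <= enorm (W t w)] ->
  \sum_(q < Q) prob (E `&`
    \bigcap_(j in `I_q)
      [set w | enorm (increment Y (h * n%:R + t * j%:R) t w) < L]) <=
  prob E / c.
Proof.
move=> h0 pE t0 c0 cL.
set p := prob [set w | L <= enorm (W t w)].
have mp := measurable_displacement_ge L t0.
have p1 : p <= 1 by exact: prob_le1.
rewrite (eq_bigr (fun q : 'I_Q => prob E * (1 - p) ^+ q)); last first.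
  move=> q _; apply: EFin_inj; rewrite -probE; last first.
    apply: measurableI; first exact: (measurable_past levyY h0 pE).
    apply: fin_bigcap_measurable => [|j _]; first exact: finite_II.
    apply: (random_vector_increment levyY _ t0 (@borel_enorm_lt0 R d L)).
    by rewrite addr_ge0// mulr_ge0.
  rewrite (past_independent levyY h0 q t0 (fun=> @borel_enorm_lt0 R d L) pE).
  rewrite EFinM -probE; last exact: (measurable_past levyY h0 pE).
  congr (_ * _)%E.
  have -> : (W t @^-1` [set x | enorm x < L]) = ~` [set w | L <= enorm (W t w)].
    by apply/seteqP; split => w /=; rewrite ltNge => /negP.
  case: q => q _ /=; elim: q => [|q IH]; first by rewrite big_geq.
  rewrite big_nat_recr//= IH exprSr EFinM probE ?prob_setC//.
  exact: measurableC.
rewrite -mulr_sumr ler_wpM2l ?prob_ge0//.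
have -> : \sum_(q < Q) (1 - p) ^+ q = (1 - (1 - p) ^+ Q) / p.
  have p0 : p != 0 by rewrite gt_eqF// (lt_le_trans c0).
  apply: (mulIf p0); rewrite divfK//.
  have := subrX1 (1 - p) Q; rewrite -(big_mkord xpredT (fun i => (1 - p) ^+ i)).
  by move=> e; rewrite -[LHS]opprK -mulrN; lra.
have p0 : 0 <= p by exact: prob_ge0.
rewrite -[leRHS]mul1r ler_pM ?invr_ge0//.
- by rewrite subr_ge0 exprn_ile1//; lra.
- by rewrite lerBlDr lerDl exprn_ge0//; lra.
- by rewrite lef_pV2// posrE (lt_le_trans c0).
Qed.

End big_displacement.

(** * Mean overshoot after a stopping time *)

Section indicator_sums.
Context {R : realType} {disp : measure_display} {T : measurableType disp}.
Variables (P : probability T R) (J : finType) (a : J -> R) (F : J -> set T).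
Hypotheses (a0 : forall j, 0 <= a j) (mF : forall j, measurable (F j)).

Lemma measurable_indic_sum :
  measurable_fun setT (fun w => \sum_j a j * \1_(F j) w : R).
Proof.
by apply: measurable_sum => j; exact: measurable_funM.
Qed.

Lemma integral_indic_sum :
  (\int[P]_w (\sum_j a j * \1_(F j) w)%:E = (\sum_j a j * prob P (F j))%:E)%E.
Proof.
under eq_integral do rewrite -sumEFin.
rewrite ge0_integral_sum//; last 2 first.
- move=> j; apply/measurable_EFinP; exact: measurable_funM.
- by move=> j w _; rewrite lee_fin mulr_ge0.
rewrite -sumEFin; apply: eq_bigr => j _.
under eq_integral do rewrite EFinM.
rewrite ge0_integralZl_EFin//; last by apply/measurable_EFinP; exact:
    measurable_indic.
by rewrite integral_indic// setIT EFinM; congr (_ * _)%E; exact: probE.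
Qed.

End indicator_sums.

Section overshoot.
Context {R : realType} {d : nat} {disp : measure_display}.
Context {T : measurableType disp} (P : probability T R).
Variable Y : R -> T -> 'rV[R]_d.
Hypothesis levyY : levy_process P Y.
Hypothesis d0 : (0 < d)%N.
Local Notation W := (displacement Y).
Local Notation prob := (prob P).
Variable rho : R.
Hypothesis rho0 : 0 < rho.

Let dR0 : 0 < d%:R :> R. Proof. by rewrite ltr0n. Qed.

(** The scales [m] to which the bound on the displacement at stopping times
applies. *)
Let slow (m : R) : Prop :=
  forall s, 0 <= s -> s <= m -> prob [set w | rho <= enorm (W s w)] <= 16^-1.

Let exists_slow : exists2 m, 0 < m & slow m.
Proof.
have /= := levy_stoch_continuous levyY (lexx 0) (divr_gt0 rho0 (ltr0n R 2)).
move=> /(_ [set y | (y < (16^-1 : R)%:E)%E]) [].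
  by apply: open_nbhs_nbhs; split; [exact: open_ereal_lt_ereal|rewrite /=
      lte_fin invr_gt0].
move=> e /= e0 he; exists (e / 2); first by rewrite divr_gt0.
move=> s s0 se; rewrite -lee_fin -probE; last exact: (measurable_displacement_ge
    levyY).
have /= := he s; rewrite sub0r normrN ger0_norm// => /(_ _ s0) hs.
have : s < e by lra.
move=> /hs /ltW; apply: le_trans.
have mW := measurable_displacement_ge levyY.
apply: le_measure; rewrite ?inE; [exact: mW| |].
  exact: (random_vector_displacement levyY s0 (@borel_enorm_gt0 R d (rho / 2))).
move=> w /= Ws; apply: lt_le_trans Ws.
by rewrite ltr_pdivrMr// ltr_pMr// ltr1n.
Qed.

(** Double a slow scale until it is no longer slow. *)
Let slow_dichotomy : (forall m, slow m) \/
  exists m t, [/\ 0 < m, slow m, 0 <= t, t <= 2 * m &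
    16^-1 < prob [set w | rho <= enorm (W t w)]].
Proof.
have [m0 m00 slow0] := exists_slow.
have [all_slow|] := pselect (forall k, slow (2 ^+ k * m0)).
  left=> m s s0 sm.
  have sm0 : 0 <= s / m0 by rewrite divr_ge0// ltW.
  apply: (all_slow (Num.bound (s / m0))) => //.
  rewrite -ler_pdivrMr// (le_trans (ltW (archi_boundP sm0)))//.
  by rewrite -natrX ler_nat ltnW// ltn_expl.
move=> /existsNP[k0 nk0]; right.
have ex : exists k, `[< ~ slow (2 ^+ k * m0) >] by exists k0; apply/asboolP.
case: (ex_minnP ex) => -[|k] /asboolP nk kmin.
  by exfalso; apply: nk; rewrite expr0 mul1r.
have slowk : slow (2 ^+ k * m0).
  apply: contrapT => h; have := kmin k; rewrite ltnn => /(_ _)/negP; apply =>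
      //.
  exact/asboolP.
move: nk => /existsNP[t] /not_implyP[t0] /not_implyP[tm] /negP.
rewrite -ltNge => ht.
exists (2 ^+ k * m0), t; split => //; first by rewrite mulr_gt0// exprn_gt0.
by rewrite mulrA -exprS.
Qed.

(** The factor [8/7 / m] bounds the probability of a large displacement per unit
of mean stopping time; [128 d m] bounds the time taken by [64 d] moves of
duration at most [2 m], and [(32 d)^-1 ^+ (64 d)] is the probability that these
moves lead out of the region. *)
Definition overshoot_cost : R :=
  8 / 7 * (128 * d%:R) / (32 * d%:R)^-1 ^+ (64 * d).

Lemma overshoot_cost_ge0 : 0 <= overshoot_cost.
Proof.
apply: divr_ge0; first by rewrite !mulr_ge0.
by rewrite exprn_ge0// invr_ge0 mulr_ge0.
Qed.

Section stopping.
Variables (h : R) (h0 : 0 < h) (M : nat) (N : T -> nat).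
Hypotheses (NM : forall w, (N w < M)%N)
  (pastN : forall i, past Y h i [set w | N w = i]).
Let hle0 : 0 <= h. Proof. exact: ltW. Qed.

Let mean_index : R := \sum_(i < M) i%:R * prob [set w | N w = i].

Let mean_index_ge0 : 0 <= mean_index.
Proof. by apply: sumr_ge0 => i _; rewrite mulr_ge0// prob_ge0. Qed.

Let far_event i : set T :=
  [set w | N w = i] `&` (W (h * i%:R) @^-1` [set x | 4 * rho <= enorm x]).

Let past_far_event i : past Y h i (far_event i).
Proof.
apply: past_setI => //; apply: grid_cylinder_displacement => //.
exact: borel_enorm_ge0.
Qed.

Let measurable_far_event i : measurable (far_event i).
Proof. exact: (measurable_past levyY hle0 (past_far_event i)). Qed.

Let far : set T := [set w | 4 * rho <= enorm (W (h * (N w)%:R) w)].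

Let measurable_far : measurable far.
Proof.
rewrite (_ : far = \bigcup_(i in [set: nat]) far_event i).
  exact: bigcupT_measurable.
by apply/seteqP; split => [w Fw|w [i _ [/= <-]]//]; exists (N w).
Qed.

Let prob_far_sum : \sum_(i < M) prob (far_event i) = prob far.
Proof.
have mN i : measurable [set w | N w = i].
  exact: (measurable_past levyY hle0 (pastN i)).
rewrite -(prob_level_sum P mN measurable_far NM); apply: eq_bigr => i _.
by congr prob; apply/seteqP; split => w /= [<-].
Qed.

Let prob_far_le m : 0 <= m -> slow m -> m * prob far <= 8 / 7 * (h *
    mean_index).
Proof.
move=> m0 slowm; pose n := (Num.trunc (m / h)).+1.
have /andP[n1 n2] := truncn_itv (divr_ge0 m0 hle0).
have near j : (j < n)%N -> prob [set w | rho <= enorm (0 + W (h * j%:R) w)] <=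
    16^-1.
  rewrite ltnS => jn; under eq_set do rewrite add0r.
  apply: slowm; first by rewrite mulr_ge0.
  by rewrite mulrC -ler_pdivlMr// (le_trans _ n1)// ler_nat.
have := displacement_at_stopping levyY hle0 (ltn0Sn _) near NM pastN.
rewrite -/mean_index -/far => ES.
have : m * prob far <= h * (n%:R * prob far).
  rewrite mulrA ler_wpM2r ?prob_ge0// [leRHS]mulrC -ler_pdivrMr//.
  exact: ltW.
have : h * (7 / 8 * n%:R * prob far) <= h * mean_index by rewrite ler_pM2l.
by lra.
Qed.

(** After the stopping time [h N], cut time into blocks of length [t'] such that
the displacement over a block reaches [64 rho] with probability at least [c]. As
long as the path stays in a set of diameter [64 rho], no completed block reaches
it; so [g] is [t'] times one plus the number of initial blocks that do not, up
to the horizon [L], on the event that the displacement at [h N] is at least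
[4 rho]. If all scales are slow, this event is null and [g] can be [L] on it. *)
Lemma overshoot_bound (L : R) : 0 <= L -> exists g : T -> R,
  [/\ measurable_fun setT g, (forall w, 0 <= g w),
    (forall w s, 4 * rho <= enorm (W (h * (N w)%:R) w) -> s <= L ->
      (forall u v, h * (N w)%:R <= u -> u < s -> h * (N w)%:R <= v -> v < s ->
        enorm (W v w - W u w) < 64 * rho) ->
      s <= h * (N w)%:R + g w) &
    (\int[P]_w (g w)%:E <= (overshoot_cost * (h * mean_index))%:E)%E].
Proof.
move=> L0; have [all_slow|[m [t [m0 slowm t0 tm ht]]]] := slow_dichotomy.
  have far0 : prob far = 0.
    apply/eqP; rewrite eq_le prob_ge0 andbT.
    apply/ler_addgt0Pl => e e0; rewrite addr0.
    pose m := 8 / 7 * (h * mean_index) / e.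
    have m0 : 0 <= m by rewrite divr_ge0 ?mulr_ge0 ?invr_ge0 // ltW.
    have := prob_far_le (addr_ge0 m0 ler01) (@all_slow _).
    have -> : 8 / 7 * (h * mean_index) = m * e by rewrite /m divfK// gt_eqF.
    rewrite leNgt => /negP H; rewrite leNgt; apply/negP => ef; apply: H.
    rewrite (@le_lt_trans _ _ ((m + 1) * e))//.
      by apply: ler_wpM2r; [exact: ltW|rewrite lerDl].
    by rewrite ltr_pM2l// ltr_wpDl.
  exists (fun w => \sum_(i < 1) L * \1_far w).
  split.
  - exact: measurable_indic_sum.
  - by move=> w; apply: sumr_ge0 => i _; rewrite mulr_ge0.
  - move=> w s fw sL _; rewrite big_ord1 indicE mem_set// mulr1.
    by rewrite (le_trans sL)// lerDr mulr_ge0.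
  - rewrite (@integral_indic_sum _ _ _ P _ (fun=> L) (fun=> far))// big_ord1
      far0 mulr0 lee_fin.
    exact: mulr_ge0 overshoot_cost_ge0 (mulr_ge0 hle0 mean_index_ge0).
have tpos : 0 < t.
  rewrite lt_neqAle t0 andbT; apply: contraTneq ht => <-.
  rewrite (_ : mkset _ = set0); first by rewrite -leNgt /prob measure0 invr_ge0.
  by apply/seteqP; split => w //=; rewrite displacement0 enorm0 leNgt rho0.
(* [k] moves of size [rho / d] in one direction add up to [64 rho]. *)
pose k := (64 * d)%N.
pose t' := t * k%:R.
have t'0 : 0 < t' by rewrite mulr_gt0// ltr0n muln_gt0.
pose c := (32 * d%:R)^-1 ^+ k : R.
have c0 : 0 < c by rewrite exprn_gt0// invr_gt0 mulr_gt0.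
have hc : c <= prob [set w | 64 * rho <= enorm (W t' w)].
  have := prob_big_displacement levyY k d0 t0 ht.
  have -> : k%:R * (rho / d%:R) = 64 * rho.
    by rewrite natrM; field; rewrite gt_eqF.
  exact.
pose Q := Num.bound (L / t').
have QL : L <= t' * Q%:R.
  by rewrite mulrC -ler_pdivrMr// ltW// archi_boundP// divr_ge0// ltW.
pose conf i q := \bigcap_(j in `I_q)
  [set w | enorm (increment Y (h * i%:R + t' * j%:R) t' w) < 64 * rho].
have mconf i q : measurable (conf i q).
  apply: fin_bigcap_measurable => [|j _]; first exact: finite_II.
  apply: (random_vector_increment levyY _ (ltW t'0) (@borel_enorm_lt0 R d _)).
  by rewrite addr_ge0// mulr_ge0// ltW.
pose F (p : 'I_M * 'I_Q) := far_event p.1 `&` conf p.1 p.2.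
have mF p : measurable (F p) by exact: measurableI.
exists (fun w => \sum_p t' * \1_(F p) w); split.
- exact: measurable_indic_sum.
- by move=> w; apply: sumr_ge0 => i _; rewrite mulr_ge0// ltW.
- move=> w s fw sL close.
  set S := h * (N w)%:R in close *.
  have -> : \sum_p t' * \1_(F p) w = \sum_(q < Q) t' * \1_(conf (N w) q) w.
    rewrite -(pair_bigA _ (fun (i : 'I_M) (q : 'I_Q) => t' * \1_(far_event i `&`
        conf i q) w))/=.
    rewrite (bigD1 (Ordinal (NM w)))//= [X in _ + X]big1 ?addr0.
      apply: eq_bigr => q _; rewrite !indicE in_setI; congr (_ * (nat_of_bool
          _)%:R).
      by rewrite [X in X && _]mem_set.
    move=> i iN; rewrite big1// => q _; rewrite indicE memNset ?mulr0//.
    move=> [[/= Ni _] _]; move/eqP: iN; apply; exact/val_inj.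
  have : forall q, s <= S + \sum_(j < q) t' * \1_(conf (N w) j) w \/
      (S + t' * q%:R < s /\ \sum_(j < q) t' * \1_(conf (N w) j) w = t' * q%:R).
    elim=> [|q [IH|[IH sumq]]].
    - rewrite big_ord0 mulr0 addr0; have [|] := leP s S; first by left.
      by right.
    - left; rewrite big_ord_recr/= addrA (le_trans IH)// lerDl mulr_ge0//.
      exact: ltW.
    - have -> : \sum_(j < q.+1) t' * \1_(conf (N w) j) w = t' * q.+1%:R.
        rewrite big_ord_recr/= sumq indicE mem_set ?mulr1 -?natr1 ?mulrDr
            ?mulr1//.
        move=> j /= jq.
        have jq' : S + t' * j.+1%:R < s.
          by apply: le_lt_trans IH; rewrite lerD2l ler_pM2l// ler_nat.
        have := close (S + t' * j%:R) (S + t' * j.+1%:R).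
        rewrite !lerDl !mulr_ge0 ?(ltW t'0)// => /(_ isT _ isT jq').
        have -> : W (S + t' * j.+1%:R) w - W (S + t' * j%:R) w =
            increment Y (S + t' * j%:R) t' w.
          rewrite -natr1 mulrDr mulr1 addrA displacementD.
          by rewrite [LHS]addrC addKr.
        apply; apply: le_lt_trans jq'.
        by rewrite lerD2l ler_pM2l// ler_nat.
      have [|] := leP s (S + t' * q.+1%:R); first by left.
      by right.
  move=> /(_ Q)[//|[Qs _]].
  have : S + t' * Q%:R < t' * Q%:R by rewrite (lt_le_trans Qs)// (le_trans sL).
  by rewrite gtrDr ltNge mulr_ge0.
- rewrite integral_indic_sum//; last by move=> _; exact: ltW.
  rewrite lee_fin -mulr_sumr.
  rewrite -(pair_bigA _ (fun (i : 'I_M) (q : 'I_Q) => prob (far_event i `&` conf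
      i q)))/=.
  have sum_le : \sum_(i < M) \sum_(q < Q) prob (far_event i `&` conf i q) <=
      prob far / c.
    rewrite -prob_far_sum mulr_suml; apply: ler_sum => i _.
    exact: (confined_sum_le levyY Q hle0 (past_far_event i) (ltW t'0) c0 hc).
  rewrite (le_trans (ler_wpM2l (ltW t'0) sum_le))//.
  have tm' : t' <= m * (128 * d%:R).
    rewrite /t' /k natrM (_ : m * _ = 2 * m * (64 * d%:R)); last by ring.
    by rewrite ler_pM2r// mulr_gt0.
  rewrite [leLHS]mulrA ler_pdivrMr//.
  have -> : overshoot_cost * (h * mean_index) * c =
      8 / 7 * (h * mean_index) * (128 * d%:R).
    rewrite /overshoot_cost -/k -/c; field; exact: lt0r_neq0.
  rewrite (@le_trans _ _ (m * (128 * d%:R) * prob far))//.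
    by rewrite ler_wpM2r// prob_ge0.
  rewrite mulrAC ler_wpM2r//; last exact: (prob_far_le (ltW m0)).
Qed.

End stopping.

End overshoot.

(** * Exit times along dyadic grids *)

Section find_iota.
Variables (p : pred nat) (m : nat).

Lemma find_iota_le : (find p (iota 0 m) <= m)%N.
Proof. by rewrite (leq_trans (find_size _ _))// size_iota. Qed.

Lemma find_iota_before j : (j < find p (iota 0 m))%N -> p j = false.
Proof.
move=> jf; have := before_find 0%N jf.
by rewrite nth_iota ?add0n// (leq_trans jf)// find_iota_le.
Qed.

Lemma find_iota_at : (find p (iota 0 m) < m)%N -> p (find p (iota 0 m)).
Proof.
move=> fm; have := @nth_find _ 0%N p (iota 0 m).
by rewrite has_find size_iota fm nth_iota ?add0n//; apply.
Qed.

Lemma find_iota_leq j : (j < m)%N -> p j -> (find p (iota 0 m) <= j)%N.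
Proof.
by move=> jm pj; rewrite leqNgt; apply/negP => /find_iota_before; rewrite pj.
Qed.

Lemma find_iota_geq j : (j <= m)%N -> (forall i, (i < j)%N -> ~~ p i) ->
  (j <= find p (iota 0 m))%N.
Proof.
move=> jm np; rewrite leqNgt; apply/negP => fj.
by have := np _ fj; rewrite find_iota_at// (leq_trans fj).
Qed.

End find_iota.

Section grid_exit.
Context {R : realType} {d : nat}.
Implicit Types (y : R -> 'rV[R]_d) (K : set 'rV[R]_d) (L k : nat).

Definition mesh k : R := (2 ^+ k)^-1.

Lemma mesh_gt0 k : 0 < mesh k.
Proof. by rewrite invr_gt0 exprn_gt0. Qed.

Lemma meshS k : mesh k = mesh k.+1 * 2.
Proof. by rewrite /mesh exprS invfM mulrAC mulVf ?mul1r. Qed.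

Lemma mesh_cvg e : 0 < e -> \forall k \near \oo, mesh k < e.
Proof.
move=> e0; have := near_infty_natSinv_lt (PosNum e0).
move=> [k0 _ h]; exists k0 => // k /h /=; apply: le_lt_trans.
rewrite lef_pV2 ?posrE ?exprn_gt0// -natrX ler_nat.
exact: ltn_expl.
Qed.

(** Equal to the number [L * 2 ^ k] of grid times before the horizon [L] when
    the
path stays in [K] until then. *)
Definition grid_exit_index L k y K : nat :=
  find (fun j => y (mesh k * j%:R) \notin K) (iota 0 (L * 2 ^ k)).

Definition grid_exit L k y K : R := mesh k * (grid_exit_index L k y K)%:R.

Lemma mesh_horizon L k : mesh k * (L * 2 ^ k)%:R = L%:R.
Proof. by rewrite natrM natrX mulrCA mulVf ?mulr1// expf_neq0. Qed.

Lemma grid_exit_ge0 L k y K : 0 <= grid_exit L k y K.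
Proof. by rewrite mulr_ge0// ltW// mesh_gt0. Qed.

Lemma grid_exit_le L k y K : grid_exit L k y K <= L%:R.
Proof.
by rewrite -(mesh_horizon L k) ler_pM2l ?mesh_gt0// ler_nat find_iota_le.
Qed.

Lemma grid_exit_lt_index L k y K :
  (grid_exit L k y K < L%:R) = (grid_exit_index L k y K < L * 2 ^ k)%N.
Proof. by rewrite -(mesh_horizon L k) ltr_pM2l ?mesh_gt0// ltr_nat. Qed.

Lemma grid_exit_notin L k y K : grid_exit L k y K < L%:R ->
  ~ K (y (grid_exit L k y K)).
Proof.
rewrite grid_exit_lt_index => /find_iota_at.
by rewrite notin_setE.
Qed.

(** Each grid refines the preceding one. *)
Lemma grid_exit_nonincreasing L y K : nonincreasing_seq (grid_exit L ^~ y ^~ K).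
Proof.
apply/nonincreasing_seqP => k.
have [->|] := eqVneq (grid_exit L k y K) L%:R; first exact: grid_exit_le.
move=> ne; have lt : grid_exit L k y K < L%:R by rewrite lt_neqAle ne
    grid_exit_le.
have out := grid_exit_notin lt.
rewrite {2}/grid_exit meshS -mulrA -(natrM _ 2) ler_pM2l ?mesh_gt0// ler_nat.
apply: find_iota_leq.
  by rewrite expnS mulnCA ltn_pmul2l// -grid_exit_lt_index.
by rewrite notin_setE natrM mulrA -meshS.
Qed.

Lemma le_grid_exit L k y K K' : K `<=` K' ->
  grid_exit L k y K <= grid_exit L k y K'.
Proof.
move=> KK'; rewrite ler_pM2l ?mesh_gt0// ler_nat.
apply: find_iota_geq; first exact: find_iota_le.
move=> i /find_iota_before/negbFE; rewrite inE => Ki.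
by rewrite negbK inE; exact: KK'.
Qed.

(** A grid time falls into the interval [t, t + e) as soon as the mesh is less
than [e]. *)
Lemma grid_exit_near L y K t e : 0 <= t -> t < L%:R -> 0 < e ->
  (forall s, t <= s -> s < t + e -> ~ K (y s)) ->
  \forall k \near \oo, grid_exit L k y K <= t + e.
Proof.
move=> t0 tL e0 out.
pose e' := Num.min e (L%:R - t).
have e'0 : 0 < e' by rewrite lt_min e0 subr_gt0.
have [k0 _ hk] := mesh_cvg e'0; exists k0 => // k /hk /= ke.
pose j := (Num.trunc (t / mesh k)).+1.
have /andP[j1 j2] := truncn_itv (divr_ge0 t0 (ltW (mesh_gt0 k))).
have tj : t <= mesh k * j%:R.
  by rewrite mulrC -ler_pdivrMr ?mesh_gt0// ltW.
have jt : mesh k * j%:R < t + e'.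
  rewrite /j -natr1 mulrDr mulr1 ler_ltD// mulrC -ler_pdivlMr//.
  exact: mesh_gt0.
have jL : mesh k * j%:R < L%:R.
  by rewrite (lt_le_trans jt)// -lerBrDl ge_min lexx orbT.
have jte : mesh k * j%:R < t + e.
  by rewrite (lt_le_trans jt)// lerD2l ge_min lexx.
rewrite (le_trans _ (ltW jte))// ler_pM2l ?mesh_gt0// ler_nat.
apply: find_iota_leq.
  by rewrite -(ltr_nat R) -(ltr_pM2l (mesh_gt0 k)) mesh_horizon.
by rewrite notin_setE; exact: out.
Qed.

(** For right-continuous paths and closed [K], the minimum of [L] and the exit
time from [K]. *)
Definition limit_exit L y K : R := inf (range (grid_exit L ^~ y ^~ K)).

Let grid_exit_has_inf L y K : has_inf (range (grid_exit L ^~ y ^~ K)).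
Proof.
split; first by exists (grid_exit L 0 y K), 0%N.
by exists 0 => _ [k _ <-]; exact: grid_exit_ge0.
Qed.

Lemma limit_exit_le_grid L k y K : limit_exit L y K <= grid_exit L k y K.
Proof. by apply: ge_inf; [case: (grid_exit_has_inf L y K)|exists k]. Qed.

Lemma limit_exit_ge0 L y K : 0 <= limit_exit L y K.
Proof.
apply: lb_le_inf; first by case: (grid_exit_has_inf L y K).
by move=> _ [k _ <-]; exact: grid_exit_ge0.
Qed.

Lemma limit_exit_le L y K : limit_exit L y K <= L%:R.
Proof. exact: le_trans (limit_exit_le_grid L 0 y K) (grid_exit_le _ _ _ _). Qed.

Lemma grid_exit_cvg L y K :
  grid_exit L k y K @[k --> \oo] --> limit_exit L y K.
Proof.
apply: nonincreasing_cvgn; first exact: grid_exit_nonincreasing.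
by case: (grid_exit_has_inf L y K).
Qed.

Lemma grid_exit_lt_near L y K e : 0 < e ->
  \forall k \near \oo, grid_exit L k y K < limit_exit L y K + e.
Proof.
move=> e0; have := @grid_exit_cvg L y K.
move=> /cvgrPdist_lt/(_ e e0)[k0 _ hk]; exists k0 => // k /hk /=.
rewrite distrC ltr_norml => /andP[_]; rewrite ltrBlDl; exact.
Qed.

Lemma le_limit_exit L y K K' : K `<=` K' ->
  limit_exit L y K <= limit_exit L y K'.
Proof.
move=> KK'; apply: lb_le_inf; first by case: (grid_exit_has_inf L y K').
move=> _ [k _ <-].
exact: le_trans (limit_exit_le_grid _ _ _ _) (le_grid_exit _ _ _ KK').
Qed.

End grid_exit.

(** * Exhaustion of open sets and paths with left limits *)

Section shrink.
Context {R : realType} {d : nat}.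
Implicit Types (U : set 'rV[R]_d) (n : nat).

(** The points at distance at least [1 / (n + 1)] from the complement of [U]:
closed sets increasing to [U]. *)
Definition shrink U n : set 'rV[R]_d :=
  [set z | forall z', enorm (z' - z) < n.+1%:R^-1 -> U z'].

Lemma shrink_sub U n : shrink U n `<=` U.
Proof. by move=> z; apply; rewrite subrr enorm0 invr_gt0. Qed.

Lemma le_shrink U n n' : (n <= n')%N -> shrink U n `<=` shrink U n'.
Proof.
move=> nn' z Kz z' zz'; apply: Kz; apply: lt_le_trans zz' _.
by rewrite lef_pV2 ?posrE// ler_nat.
Qed.

Lemma shrinkC_open U n z : ~ shrink U n z ->
  exists2 e, 0 < e & forall z', enorm (z' - z) < e -> ~ shrink U n z'.
Proof.
move=> /existsNP[z1 /not_implyP[zz1 Uz1]].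
exists (n.+1%:R^-1 - enorm (z1 - z)); first by rewrite subr_gt0.
move=> z' zz' Kz'; apply: Uz1; apply: Kz'.
have := ler_enormD (z1 - z) (z - z'); rewrite addrA subrK -(enormN (z - z'))
    opprB.
by move=> /le_lt_trans; apply; rewrite -ltrBrDl.
Qed.

Lemma borel_shrink U n : borel R d (shrink U n).
Proof.
rewrite -(setCK (shrink U n)); apply: borelC; apply: borel_open.
rewrite openE => z /shrinkC_open[e e0 he]; apply/nbhs_enormP.
by exists e => // z' zz'; apply: he; rewrite -enormN opprB.
Qed.

Lemma shrink_cover U z : open U -> U z ->
  exists2 e, 0 < e & \forall n \near \oo, forall z', enorm (z' - z) < e ->
      shrink U n z'.
Proof.
move=> oU Uz; have /nbhs_enormP[e e0 he] := open_nbhs_nbhs (conj oU Uz).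
exists (e / 2); first by rewrite divr_gt0.
have [n0 _ hn] := near_infty_natSinv_lt (PosNum (divr_gt0 e0 (ltr0n R 2))).
exists n0 => // n /hn /= ne z' zz' z2 zz2; apply: he.
have := ler_enormD (z - z') (z' - z2); rewrite addrA subrK.
by rewrite -(enormN (z - z')) -(enormN (z' - z2)) !opprB => h;
  have := lt_trans zz2 ne; rewrite /=; lra.
Qed.

End shrink.

Section paths.
Context {R : realType} {d : nat}.
Implicit Type y : R -> 'rV[R]_d.

Definition right_continuous_path y := forall t e, 0 <= t -> 0 < e ->
  exists2 u, 0 < u & forall s, t <= s -> s < t + u -> enorm (y s - y t) < e.

Definition left_limited_path y := forall t, 0 < t -> exists l, forall e, 0 < e
    ->
  exists2 u, 0 < u & forall s, t - u < s -> s < t -> enorm (y s - l) < e.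

Lemma cadlag_right_continuous_path y c : cadlag y ->
  right_continuous_path (fun t => c + y t).
Proof.
move=> [rc _] t e t0 e0.
have nb : nbhs (y t) [set z | enorm (y t - z) < e].
  by apply/nbhs_enormP; exists e.
have [u /= u0 hu] := rc t t0 _ nb; exists u => // s.
rewrite le_eqVlt => /orP[/eqP <- _|ts su]; first by rewrite subrr enorm0.
rewrite -enormN opprB opprD addrACA subrr add0r; apply: (hu s) => //=.
by rewrite distrC gtr0_norm ?subr_gt0// ltrBlDl.
Qed.

Lemma cadlag_left_limited y c : cadlag y ->
  left_limited_path (fun t => c + y t).
Proof.
move=> [_ ll] t t0; have [l yl] := ll t t0; exists (c + l) => e e0.
have nb : nbhs l [set z | enorm (l - z) < e] by apply/nbhs_enormP; exists e.
have [u /= u0 hu] := yl _ nb; exists u => // s tus st.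
rewrite -enormN opprB opprD addrACA subrr add0r; apply: (hu s) => //=.
by rewrite gtr0_norm ?subr_gt0// ltrBlDl -ltrBlDr.
Qed.

Lemma enorm_sub_gt0 (a b : 'rV[R]_d) : a <> b -> 0 < enorm (a - b).
Proof.
move=> ab; rewrite lt0r enorm_ge0 andbT; apply/eqP => ab0; apply: ab.
apply/rowP => i; apply/eqP; rewrite -subr_eq0 -normr_le0.
by have := le_coord_enorm (a - b) i; rewrite ab0 !mxE.
Qed.

(** If the [S' n] reach [T], right continuity gives convergence. Otherwise the
[S n k] end strictly before [T] and the path converges along them to its left
limit. If this differs from the value at [T], then a delay [1 / (p + 1)] that is
longer than the remaining time to [T] carries the path across the jump. *)
Lemma cvg_or_jump y (S : nat -> nat -> R) (S' : nat -> R) T :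
  right_continuous_path y -> left_limited_path y ->
  (forall n, 0 <= S' n) -> (forall n k, S' n <= S n k) ->
  (forall n e, 0 < e -> \forall k \near \oo, S n k < S' n + e) ->
  (forall n, S' n <= T) -> nondecreasing_seq S' ->
  (forall e, 0 < e -> \forall n \near \oo, T - e < S' n) ->
  (forall e, 0 < e ->
    \forall n \near \oo, \forall k \near \oo, enorm (y (S n k) - y T) < e) \/
  (exists q : nat, \forall p \near \oo, \forall n \near \oo, \forall k \near
      \oo,
    q.+1%:R^-1 < enorm (y (S n k + p.+1%:R^-1) - y (S n k))).
Proof.
move=> rc ll S'0 S'S SS' S'T ndS' TS'.
have T0 : 0 <= T by exact: le_trans (S'0 0%N) (S'T 0%N).
have [[n0 eqT]|neqT] := pselect (exists n, S' n = T).
  left=> e e0; have [u u0 hu] := rc T e T0 e0.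
  exists n0 => // n /= n0n.
  have S'nT : S' n = T.
    by apply/eqP; rewrite eq_le S'T/= -eqT ndS'.
  apply: filterS (SS' n u u0) => k.
  by rewrite S'nT => Sk; apply: hu => //; rewrite -S'nT.
have ltT n : S' n < T.
  by rewrite lt_neqAle S'T andbT; apply/eqP => e; apply: neqT; exists n.
have SltT n : \forall k \near \oo, S n k < T.
  apply: filterS (SS' n (T - S' n) _) => [k|]; first by rewrite subrKC.
  by rewrite subr_gt0.
have {}T0 : 0 < T by exact: le_lt_trans (S'0 0%N) (ltT 0%N).
have [l hl] := ll T T0.
have [lT|nlT] := pselect (y T = l).
  left=> e e0; have [u u0 hu] := hl e e0.
  apply: filterS (TS' u u0) => n S'n.
  apply: filterS (SltT n) => k Sk; rewrite lT; apply: hu => //.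
  exact: lt_le_trans (S'S n k).
right; have jump0 := enorm_sub_gt0 nlT; set jump := enorm _ in jump0.
have j30 : 0 < jump / 3 by rewrite divr_gt0.
have [u u0 hu] := hl _ j30.
have [v v0 hv] := rc T _ (ltW T0) j30.
have [q _ hq] := near_infty_natSinv_lt (PosNum j30).
exists q; apply: filterS (near_infty_natSinv_lt (PosNum v0)) => p /= pv.
have p0 : 0 < p.+1%:R^-1 :> R by rewrite invr_gt0.
have m0 : 0 < Num.min u p.+1%:R^-1 by rewrite lt_min u0.
apply: filterS (TS' _ m0) => n S'n.
apply: filterS (SltT n) => k Sk.
have Sn := lt_le_trans S'n (S'S n k).
have Su : T - u < S n k.
  by apply: le_lt_trans Sn; rewrite lerD2l lerN2 ge_min lexx.
have Sp : T - p.+1%:R^-1 < S n k.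
  by apply: le_lt_trans Sn; rewrite lerD2l lerN2 ge_min lexx orbT.
have e1 := hu _ Su Sk.
have e2 : enorm (y (S n k + p.+1%:R^-1) - y T) < jump / 3.
  apply: hv; first by rewrite ltW// -ltrBlDr.
  by apply: (lt_trans _ (_ : T + p.+1%:R^-1 < _)); rewrite ?ltrD2r ?ltrD2l.
have e3 : q.+1%:R^-1 < jump / 3 := hq q (leqnn q).
set a := y (S n k + _) in e2 *; set b := y (S n k) in e1 *.
have t1 := ler_enormD (y T - a) (a - l); rewrite addrA subrK in t1.
have t2 := ler_enormD (a - b) (b - l); rewrite addrA subrK in t2.
rewrite -(enormN (y T - a)) opprB in t1.
rewrite -/jump in t1.
apply: (lt_le_trans e3); lra.
Qed.

(** At [T] the path is a limit of points outside [shrink U n], hence outside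
[U]. If [T < phi], it is still in [V] at that time, so it is far from [x], and
so are the approximations. *)
Lemma grid_exit_alternative y (U V : set 'rV[R]_d) x r L phi e (T : R) :
  right_continuous_path y -> open U -> 0 < r -> 0 < e ->
  (forall z, V z -> ~ U z -> r <= enorm (z - x)) ->
  (forall n, limit_exit L y (shrink U n) <= T) ->
  (forall e, 0 < e -> \forall n \near \oo, T - e < limit_exit L y (shrink U n))
      ->
  (forall e, 0 < e -> \forall n \near \oo, \forall k \near \oo,
    enorm (y (grid_exit L k y (shrink U n)) - y T) < e) ->
  (forall t, 0 <= t -> t < phi -> V (y t)) -> phi <= L%:R ->
  \forall n \near \oo, \forall k \near \oo,
    phi <= grid_exit L k y (shrink U n) + e \/
    r / 2 <= enorm (y (grid_exit L k y (shrink U n)) - x).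
Proof.
move=> rc oU r0 e0 VU leT Tle cvgT Vphi phiL.
have T0 : 0 <= T by exact: le_trans (limit_exit_ge0 _ _ _) (leT 0%N).
have [phiT|Tphi] := leP phi T.
  apply: filterS (Tle e e0) => n Tn; near=> k; left.
  have := limit_exit_le_grid L k y (shrink U n).
  by lra.
have VT := Vphi T T0 Tphi.
have nUT : ~ U (y T).
  move=> UT; have [u u0 cover] := shrink_cover oU UT.
  have : \forall n \near \oo, \forall k \near \oo, False.
    apply: filterS2 cover (cvgT u u0) => n hn.
    apply: filterS2 (grid_exit_lt_near L y (shrink U n) (_ : 0 < L%:R - T)) =>
        [k lt near|].
      apply: (grid_exit_notin (y := y) (K := shrink U n) (L := L) (k := k)).
        by rewrite (lt_le_trans lt)// -lerBrDr opprB subrKC.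
      exact: hn.
    by rewrite subr_gt0 (lt_le_trans Tphi).
  by move=> /filter_ex[n] /filter_ex[].
have far := VU _ VT nUT.
have r20 : 0 < r / 2 by rewrite divr_gt0.
apply: filterS (cvgT _ r20) => n; apply: filterS => k near; right.
have := ler_enormD (y T - y (grid_exit L k y (shrink U n)))
  (y (grid_exit L k y (shrink U n)) - x).
rewrite addrA subrK -(enormN (y T - _)) opprB.
by lra.
Unshelve. all: by end_near.
Qed.

(** The complement of [shrink U n] is open, so by right continuity the path
spends an interval of time in it from the moment it is outside [U]. *)
Lemma limit_exit_le_exit y (U : set 'rV[R]_d) L n t : right_continuous_path y ->
  0 <= t -> ~ U (y t) -> limit_exit L y (shrink U n) <= t.
Proof.
move=> rc t0 nU; have [tL|Lt] := ltP t L%:R; last first.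
  exact: le_trans (limit_exit_le _ _ _) Lt.
have nK : ~ shrink U n (y t) by move=> /shrink_sub.
have [e e0 he] := shrinkC_open nK.
have [u u0 hu] := rc t e t0 e0.
apply/ler_addgt0Pr => v v0.
have m0 : 0 < Num.min u v by rewrite lt_min u0.
have : \forall k \near \oo, grid_exit L k y (shrink U n) <= t + Num.min u v.
  apply: grid_exit_near => // s ts su; apply: he; apply: hu => //.
  by rewrite (lt_le_trans su)// lerD2l ge_min lexx.
move=> /filter_ex[k hk].
rewrite (le_trans (limit_exit_le_grid L k y _))// (le_trans hk)//.
by rewrite lerD2l ge_min lexx orbT.
Qed.

End paths.

(** * Absence of jumps at limits of stopping times *)

Lemma borel_shift (R : realType) (d : nat) (x : 'rV[R]_d) (K : set 'rV[R]_d) :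
  borel R d K -> borel R d [set z | K (x + z)].
Proof.
move=> bK; pose vec := g_sigma_algebraType (@open 'rV[R]_d).
have rid : random_vector (id : vec -> 'rV[R]_d) by [].
exact: (random_vectorD (@random_vector_cst _ _ _ vec x) rid bK).
Qed.

Section liminf_events.
Context {R : realType} {disp : measure_display} {T : measurableType disp}.
Variables (P : probability T R) (A : nat -> set T).
Hypothesis mA : forall n, measurable (A n).

Let tails m : set T := \bigcap_(n in [set n | (m <= n)%N]) A n.

Let nearE : [set w | \forall n \near \oo, A n w] = \bigcup_m tails m.
Proof.
apply/seteqP; split => [w [m _ hm]|w [m _ hm]].
  by exists m => // n /= mn; exact: hm.
by exists m => // n /= mn; exact: hm.
Qed.

Let measurable_tails m : measurable (tails m).
Proof. by apply: bigcap_measurable => //; exists m => /=. Qed.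

Lemma measurable_near : measurable [set w | \forall n \near \oo, A n w].
Proof. by rewrite nearE; exact: bigcupT_measurable. Qed.

Lemma prob_near_le c : (\forall n \near \oo, prob P (A n) <= c) ->
  prob P [set w | \forall n \near \oo, A n w] <= c.
Proof.
move=> [n0 _ hc].
rewrite -lee_fin -probE; last exact: measurable_near.
rewrite nearE.
have nd : nondecreasing_seq tails.
  move=> m m' mm'; apply/subsetPset => w h n /= m'n; apply: h => /=.
  exact: leq_trans mm' m'n.
have cvgP := nondecreasing_cvg_mu (mu := P) measurable_tails
  (bigcupT_measurable _ measurable_tails) nd.
rewrite -(cvg_lim _ cvgP)//; apply: lime_le; first by apply/cvg_ex; eexists;
    exact: cvgP.
near=> m; rewrite /= probE// lee_fin.
apply: le_trans (hc (maxn m n0) (leq_maxr _ _)).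
by apply: le_prob => // w; apply; exact: leq_maxl.
Unshelve. all: by end_near. Qed.

End liminf_events.

Section stopped_increments.
Context {R : realType} {d : nat} {disp : measure_display}.
Context {T : measurableType disp} (P : probability T R).
Variable Y : R -> T -> 'rV[R]_d.
Hypothesis levyY : levy_process P Y.
Local Notation W := (displacement Y).
Local Notation prob := (prob P).
Variable x : 'rV[R]_d.

Definition trajectory (w : T) (t : R) : 'rV[R]_d := x + W t w.

Lemma trajectory_increment w s t : trajectory w (s + t) - trajectory w s =
    increment Y s t w.
Proof.
by rewrite /trajectory displacementD addrA [X in X - _]addrC addrK.
Qed.

Section one_grid.
Variables (L k : nat) (K : set 'rV[R]_d) (bK : borel R d K).
Let M := (L * 2 ^ k)%N.
Let N (w : T) : nat := grid_exit_index L k (trajectory w) K.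
Let mesh0 : 0 <= mesh k :> R. Proof. exact/ltW/mesh_gt0. Qed.

Lemma grid_exit_index_lt w : (N w < M.+1)%N.
Proof. by rewrite ltnS find_iota_le. Qed.

Let past_inside j i : (j <= i)%N ->
  past Y (mesh k) i [set w | K (trajectory w (mesh k * j%:R))].
Proof.
move=> ji.
have := @grid_cylinder_displacement _ _ _ _ Y (mesh k) i j ji _ (borel_shift x
    bK).
exact.
Qed.

Lemma past_grid_exit_index i : past Y (mesh k) i [set w | N w = i].
Proof.
have [iM|Mi|iM] := ltngtP i M.
- have -> : [set w | N w = i] =
      \bigcap_(j in `I_i) [set w | K (trajectory w (mesh k * j%:R))] `&`
      ~` [set w | K (trajectory w (mesh k * i%:R))].
    apply/seteqP; split => w /=.
      move=> Ni; split => [j /= ji|].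
        rewrite -Ni in ji.
        by have := find_iota_before ji; move/negbFE; rewrite inE.
      rewrite -Ni in iM *.
      by have := find_iota_at iM; rewrite notin_setE.
    move=> [inside out]; apply/eqP; rewrite eqn_leq; apply/andP; split.
      by apply: find_iota_leq => //; rewrite notin_setE.
    apply: find_iota_geq; first exact: ltnW.
    by move=> j ji; rewrite negbK inE; exact: inside.
  apply: past_setI; last by apply: past_setC; exact: past_inside.
  by apply: past_bigcap => j ji; exact/past_inside/ltnW.
- rewrite (_ : mkset _ = ~` setT); first by apply: past_setC; exact: past_setT.
  rewrite setCT; apply/seteqP; split => w //= Ni.
  by have := grid_exit_index_lt w; rewrite ltnS Ni leqNgt Mi.
- have -> : [set w | N w = i] =
      \bigcap_(j in `I_i) [set w | K (trajectory w (mesh k * j%:R))].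
    apply/seteqP; split => w /=.
      move=> <- j /= jN.
      by have := find_iota_before jN; move/negbFE; rewrite inE.
    move=> inside; apply/eqP; rewrite eqn_leq {1}iM find_iota_le/=.
    apply: find_iota_geq; first by rewrite iM.
    by move=> j ji; rewrite negbK inE; exact: inside.
  by apply: past_bigcap => j ji; exact/past_inside/ltnW.
Qed.

Let mN i : measurable [set w | N w = i].
Proof. exact: (measurable_past levyY mesh0 (past_grid_exit_index i)). Qed.

Let grid_exitE w : grid_exit L k (trajectory w) K =
  \sum_(i < M.+1) (mesh k * i%:R) * \1_[set w | N w = i] w.
Proof.
rewrite (bigD1 (Ordinal (grid_exit_index_lt w)))//= indicE mem_set// mulr1.
rewrite big1 ?addr0// => i iN; rewrite indicE memNset ?mulr0// => /= Ni.
by move/eqP: iN; apply; apply: val_inj.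
Qed.

Lemma measurable_grid_exit :
  measurable_fun setT (fun w => grid_exit L k (trajectory w) K).
Proof. by under eq_fun do rewrite grid_exitE; exact: measurable_indic_sum. Qed.

Lemma integral_grid_exit :
  (\int[P]_w (grid_exit L k (trajectory w) K)%:E =
   (mesh k * \sum_(i < M.+1) i%:R * prob [set w | N w = i])%:E)%E.
Proof.
under eq_integral do rewrite grid_exitE.
rewrite integral_indic_sum//; last by move=> i; rewrite mulr_ge0.
by congr _%:E; rewrite mulr_sumr; apply: eq_bigr => i _; rewrite mulrA.
Qed.

Let moved u eps : set T := [set w | eps <
  enorm (trajectory w (grid_exit L k (trajectory w) K + u) - trajectory w
      (grid_exit L k (trajectory w) K))].

Let moved_level u eps i : [set w | N w = i] `&` moved u eps =
  [set w | N w = i] `&`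
  increment Y (mesh k * i%:R) u @^-1` [set z | eps < enorm z].
Proof.
by apply/seteqP; split => w /= [Ni]; rewrite /moved/= trajectory_increment
    /grid_exit -/(N w) Ni.
Qed.

Lemma measurable_moved u eps : 0 <= u -> measurable (moved u eps).
Proof.
move=> u0.
rewrite (_ : moved u eps = \bigcup_i ([set w | N w = i] `&` moved u eps)).
  apply: bigcupT_measurable => i; rewrite moved_level; apply: measurableI => //.
  apply: (random_vector_increment levyY _ u0 (@borel_enorm_gt0 R d eps)).
  by rewrite mulr_ge0.
by apply/seteqP; split => [w mw|w [i _ []//]]; exists (N w).
Qed.

(** Split over the values of the stopping index. *)
Lemma prob_moved u eps : 0 <= u ->
  prob (moved u eps) = prob [set w | eps < enorm (W u w)].
Proof.
move=> u0.
rewrite -(prob_level_sum P mN (measurable_moved eps u0) grid_exit_index_lt).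
rewrite -[RHS]mul1r -(prob_setT P).
rewrite -(prob_level_sum P mN measurableT grid_exit_index_lt) mulr_suml.
apply: eq_bigr => i _; rewrite setIT moved_level.
have bgt := @borel_enorm_gt0 R d eps.
apply: EFin_inj; rewrite EFinM -!probE//.
- exact: past_independent1 (past_grid_exit_index i).
- exact: (random_vector_displacement levyY u0 bgt).
- apply: measurableI => //.
  by apply: (random_vector_increment levyY _ u0 bgt); rewrite mulr_ge0.
Qed.

End one_grid.

Lemma displacement_small eps e : 0 < eps -> 0 < e ->
  \forall p \near \oo, prob [set w | eps < enorm (W p.+1%:R^-1 w)] <= e.
Proof.
move=> eps0 e0.
have /= := levy_stoch_continuous levyY (lexx 0) eps0.
move=> /(_ [set y | (y < e%:E)%E]) [].
  by apply: open_nbhs_nbhs; split; [exact: open_ereal_lt_ereal|rewrite /=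
      lte_fin].
move=> u /= u0 hu; apply: filterS (near_infty_natSinv_lt (PosNum u0)) => p /=
    pu.
have p0 : 0 <= p.+1%:R^-1 :> R by [].
rewrite -lee_fin -probE; last first.
  exact: (random_vector_displacement levyY p0 (@borel_enorm_gt0 R d eps)).
apply: ltW; apply: hu => //=.
by rewrite sub0r normrN ger0_norm.
Qed.

(** The increments of length [1 / (p + 1)] after the stopping times have the law
of [W] at that time, whatever the stopping time, and tend to [0] in
probability. *)
Lemma no_jump_at_limit (L : nat) (K : nat -> set 'rV[R]_d) :
  (forall n, borel R d (K n)) ->
  {ae P, forall w, ~ exists q : nat,
    \forall p \near \oo, \forall n \near \oo, \forall k \near \oo,
      q.+1%:R^-1 < enorm (trajectory w (grid_exit L k (trajectory w) (K n) +
          p.+1%:R^-1) -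
                          trajectory w (grid_exit L k (trajectory w) (K n)))}.
Proof.
move=> bK.
pose A q p n k := [set w | q.+1%:R^-1 <
  enorm (trajectory w (grid_exit L k (trajectory w) (K n) + p.+1%:R^-1) -
         trajectory w (grid_exit L k (trajectory w) (K n)))].
have mA q p n k : measurable (A q p n k) by exact: measurable_moved.
have mA1 q p n : measurable [set w | \forall k \near \oo, A q p n k w].
  exact: measurable_near.
have mA2 q p : measurable [set w | \forall n \near \oo, \forall k \near \oo, A q
    p n k w].
  exact: (measurable_near (mA1 q p)).
have mA3 q : measurable [set w | \forall p \near \oo, \forall n \near \oo,
    \forall k \near \oo, A q p n k w].
  exact: (measurable_near (mA2 q)).
have A0 q : P [set w | \forall p \near \oo, \forall n \near \oo,
    \forall k \near \oo, A q p n k w] = 0%E.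
  rewrite probE//; congr _%:E; apply/eqP; rewrite eq_le prob_ge0 andbT.
  apply/ler_addgt0Pl => e e0; rewrite addr0.
  apply: (prob_near_le (mA2 q)).
  have q0 : 0 < q.+1%:R^-1 :> R by rewrite invr_gt0.
  apply: filterS (displacement_small q0 e0) => p hp.
  apply: (prob_near_le (mA1 q p)); apply: nearW => n.
  apply: (prob_near_le (mA q p n)); apply: nearW => k.
  by rewrite prob_moved.
have : forall q, {ae P, forall w, ~ \forall p \near \oo, \forall n \near \oo,
    \forall k \near \oo, A q p n k w}.
  move=> q; exists [set w | \forall p \near \oo, \forall n \near \oo,
    \forall k \near \oo, A q p n k w]; split => // w /=.
  exact: contrapT.
by move/ae_foralln; apply: filterS => w h [q]; exact: h.
Qed.

End stopped_increments.

(** * Fatou and lower integrals *)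
Import HBNNSimple.

Section limits_of_integrals.
Context {R : realType} {disp : measure_display} {T : measurableType disp}.
Variable mu : {measure set T -> \bar R}.
Local Open Scope ereal_scope.

Lemma le_limn_einf (u : (\bar R)^nat) a :
  (\forall n \near \oo, a <= u n) -> a <= limn_einf u.
Proof.
move=> [N _ hN]; rewrite limn_einf_lim; apply: lime_ge; first exact:
    is_cvg_einfs.
exists N => // n /= Nn; apply: le_ereal_inf_tmp => _ [m /= nm <-].
by apply: hN => /=; exact: leq_trans nm.
Qed.

Lemma limn_einf_le (u v : (\bar R)^nat) l : (forall n, u n <= v n) ->
  v @ \oo --> l -> limn_einf u <= l.
Proof.
move=> uv vl; rewrite limn_einf_lim -(cvg_lim _ vl)//.
apply: lee_lim; [exact: is_cvg_einfs|by apply/cvg_ex; exists l|].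
near=> n; apply: le_trans (uv n); apply: ereal_inf_lbound.
by exists n => /=.
Unshelve. all: by end_near. Qed.

Lemma measurable_limn_einf (f : (T -> \bar R)^nat) :
  (forall n, measurable_fun setT (f n)) ->
  measurable_fun setT (fun w => limn_einf (f ^~ w)).
Proof.
move=> mf; apply: (@emeasurable_fun_cvg _ _ _ _ (fun n w => einfs (f ^~ w) n)).
  by move=> n; exact: measurable_fun_einfs.
by move=> w _; rewrite limn_einf_lim; exact: is_cvg_einfs.
Qed.

Lemma limn_einf_ge0 (u : (\bar R)^nat) : (forall n, 0 <= u n) -> 0 <= limn_einf
    u.
Proof. by move=> u0; apply: le_limn_einf; exact: nearW. Qed.

Lemma iterated_fatou (phi : T -> \bar R) (f : nat -> nat -> T -> \bar R) c :
  measurable_fun setT phi -> (forall w, 0 <= phi w) ->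
  (forall n k, measurable_fun setT (f n k)) ->
  (forall n k w, 0 <= f n k w) ->
  {ae mu, forall w, forall e : R, (0 < e)%R ->
    \forall n \near \oo, \forall k \near \oo, phi w <= f n k w + e%:E} ->
  (forall n, limn_einf (fun k => \int[mu]_w f n k w) <= c) ->
  \int[mu]_w phi w <= c.
Proof.
move=> mphi phi0 mf f0 near fc.
pose F n w := limn_einf (fun k => f n k w).
have mF n : measurable_fun setT (F n) by exact: measurable_limn_einf.
have F0 n w : 0 <= F n w by exact: limn_einf_ge0.
apply: (@le_trans _ _ (\int[mu]_w limn_einf (F ^~ w))).
  apply: ae_ge0_le_integral => //.
  - by move=> w _; exact: limn_einf_ge0.
  - exact: measurable_limn_einf.
  apply: filterS near => w near _.
  apply/lee_addgt0Pr => e e0.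
  rewrite addeC -limn_einf_shift//; apply: le_limn_einf.
  apply: filterS (near e e0) => n nearn.
  rewrite /F -limn_einf_shift//; apply: le_limn_einf.
  by apply: filterS nearn => k; rewrite addeC.
apply: le_trans (fatou _ _ _ _) _ => //.
apply: (@limn_einf_le _ (cst c)); last exact: cvg_cst.
move=> n; apply: le_trans (fatou _ _ _ _) _ => //.
Qed.

(** The integral of a nonnegative function is a supremum over the simple
functions below it, which makes it monotone without measurability. *)
Lemma le_integral_lower (f g : T -> \bar R) : (forall w, 0 <= f w) ->
  (forall w, f w <= g w) -> \int[mu]_w f w <= \int[mu]_w g w.
Proof.
move=> f0 fg; rewrite !ge0_integralTE//; last first.
  by move=> w; exact: le_trans (f0 w) (fg w).
apply: le_ereal_sup => _ [s sf <-]; exists s => // w.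
exact: le_trans (sf w) (fg w).
Qed.

Lemma ae_le_integral_lower (f g : T -> \bar R) :
  measurable_fun setT f -> (forall w, 0 <= f w) -> (forall w, 0 <= g w) ->
  {ae mu, forall w, f w <= g w} -> \int[mu]_w f w <= \int[mu]_w g w.
Proof.
move=> mf f0 g0 [N [mN N0 fgN]].
rewrite (@ge0_negligible_integral _ _ _ mu setT N f)//.
rewrite integral_mkcond; apply: le_integral_lower => w; rewrite patchE; case:
    ifP => //.
rewrite setTD inE => Nw; apply: contrapT => nfg; apply: Nw; exact: fgN.
Qed.

(** Simple functions are bounded since their range is finite. *)
Lemma integral_le_bounded (g : T -> \bar R) c : (forall w, 0 <= g w) ->
  (forall (L : nat) (phi : T -> R), measurable_fun setT phi ->
    (forall w, 0 <= phi w)%R -> (forall w, phi w <= L%:R)%R ->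
    (forall w, (phi w)%:E <= g w) -> \int[mu]_w (phi w)%:E <= c) ->
  \int[mu]_w g w <= c.
Proof.
move=> g0 hc; rewrite ge0_integralTE//; apply: ge_ereal_sup => _ [s sg <-].
rewrite -integralT_nnsfun.
have [fs Es] : exists B : seq R, forall w, s w \in B.
  exists (finmap.enum_fset (fset_set (range s))) => w; rewrite in_fset_set//.
  by rewrite inE; exists w.
apply: (hc (Num.bound (\sum_(v <- fs) `|v|))) => //.
move=> w; have S0 : (0 <= \sum_(v <- fs) `|v|)%R by exact: sumr_ge0.
rewrite (le_trans _ (ltW (archi_boundP S0)))// (le_trans (ler_norm _))//.
have := Es w; elim: {Es S0} fs => // v B IH; rewrite inE big_cons => /orP[/eqP
    <-|/IH h].
  by rewrite lerDl sumr_ge0.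
by rewrite (le_trans h)// lerDr.
Qed.

End limits_of_integrals.

(** * Comparison of mean exit times *)

Section exit_times.
Context {R : realType} {d : nat}.
Implicit Types (f : R -> 'rV[R]_d) (B : set 'rV[R]_d).
Local Open Scope ereal_scope.

Lemma exit_time_ge0 f B : 0 <= exit_time f B.
Proof. by apply: le_ereal_inf_tmp => _ [t [t0 _] <-]; rewrite lee_fin. Qed.

Lemma exit_time_inside f B (s t : R) : s%:E <= exit_time f B ->
  (0 <= t)%R -> (t < s)%R -> B (f t).
Proof.
move=> sexit t0 ts; apply: contrapT => nB.
suff : exit_time f B <= t%:E by move=> /(le_trans sexit); rewrite lee_fin leNgt
    ts.
by apply: ereal_inf_lbound; exists t.
Qed.

End exit_times.

Lemma eball_diff (R : realType) (d : nat) (D : set 'rV[R]_d) z0 x r z :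
  eball z0 r x -> (D `&` eball z0 (4 * r)) z -> ~ (D `&` eball z0 (2 * r)) z ->
  r <= enorm (z - x).
Proof.
rewrite /eball/= => xr [Dz _] nz.
have : 2 * r <= enorm (z - z0) by rewrite leNgt; apply/negP => h; apply: nz.
have := ler_enormD (z - x) (x - z0); rewrite addrA subrK.
by lra.
Qed.

Lemma open_eball (R : realType) (d : nat) (z0 : 'rV[R]_d) r : open (eball z0 r).
Proof.
have /continuousP := @enorm_shift_continuous R d (- z0).
by move=> /(_ [set u : R | u < r]); apply; exact: open_lt.
Qed.

Section main.
Context {R : realType} {d : nat} {disp : measure_display}.
Context {T : measurableType disp} (P : probability T R).
Variable Y : R -> T -> 'rV[R]_d.
Hypothesis levyY : levy_process P Y.
Hypothesis d0 : (0 < d)%N.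
Variables (D : set 'rV[R]_d) (z0 x : 'rV[R]_d) (r : R).
Hypotheses (openD : open D) (r0 : 0 < r) (xr : eball z0 r x).
Local Notation W := (displacement Y).
Let U := D `&` eball z0 (2 * r).
Let V := D `&` eball z0 (4 * r).
Let openU : open U.
Proof. by apply: openI => //; exact: open_eball. Qed.

Variable L : nat.
Let S n k w := grid_exit L k (trajectory Y x w) (shrink U n).
Let S' n w := limit_exit L (trajectory Y x w) (shrink U n).

Let regular (w : T) : Prop :=
  [/\ right_continuous_path (trajectory Y x w), left_limited_path (trajectory Y
      x w) &
      forall t, x + Y t w = trajectory Y x w t].

Let ae_regular : {ae P, forall w, regular w}.
Proof.
apply: filterS2 (levy_cadlag levyY) (levy_start0 levyY) => w cad Y0.
have pathE : trajectory Y x w = fun t => x + Y t w.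
  by apply/funext => t; rewrite /trajectory /displacement Y0 subr0.
split; rewrite pathE //; first exact: (cadlag_right_continuous_path x cad).
exact: (cadlag_left_limited x cad).
Qed.

Let measurable_S n k : measurable_fun setT (S n k).
Proof. by apply: (measurable_grid_exit levyY); exact: borel_shrink. Qed.

Let S_cvg n w : S n k w @[k --> \oo] --> S' n w.
Proof. exact: grid_exit_cvg. Qed.

Let measurable_S' n : measurable_fun setT (S' n).
Proof. by apply: (measurable_fun_cvg (h := S n)) => // w _; exact: S_cvg. Qed.

Local Open Scope ereal_scope.

Let integral_S_cvg n :
  \int[P]_w (S n k w)%:E @[k --> \oo] --> \int[P]_w (S' n w)%:E.
Proof.
have [] // := @dominated_convergence _ T R P setT measurableT
  (fun k w => (S n k w)%:E) (fun w => (S' n w)%:E) (fun=> (L%:R)%:E).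
- by move=> k; exact/measurable_EFinP.
- exact/measurable_EFinP.
- apply: aeW => w _; apply: cvg_EFin; first exact: nearW.
  exact: S_cvg.
- exact: finite_measure_integrable_cst.
- apply: aeW => w k _; rewrite lee_fin ger0_norm; first exact: grid_exit_le.
  exact: grid_exit_ge0.
Qed.

(** The only place where the mean exit time from [U] is bounded from below. *)
Let integral_S'_le n :
  \int[P]_w (S' n w)%:E <= mean_exit_time P Y x U.
Proof.
apply: ae_le_integral_lower.
- exact/measurable_EFinP.
- by move=> w; rewrite lee_fin limit_exit_ge0.
- by move=> w; exact: exit_time_ge0.
apply: filterS ae_regular => w [rc _ pathE].
apply: le_ereal_inf_tmp => _ [t [t0 nU] <-]; rewrite lee_fin.
by apply: limit_exit_le_exit => //; rewrite -pathE.
Qed.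

Let S'_nondecreasing w : nondecreasing_seq (S' ^~ w).
Proof. by move=> n n' nn'; apply: le_limit_exit; exact: le_shrink. Qed.

(** The function [h n k] is the grid exit time from [shrink U n] plus the
overshoot. It dominates [phi] in the limit: where the grid exit ends far from
[x], by the choice of the overshoot [g], and elsewhere by
[grid_exit_alternative]. *)
Lemma mean_exit_le (phi : T -> R) : measurable_fun setT phi -> (forall w, 0 <=
    phi w)%R ->
  (forall w, phi w <= L%:R)%R ->
  (forall w, (phi w)%:E <= exit_time (fun t => (x + Y t w)%R) V) ->
  \int[P]_w (phi w)%:E <= (1 + overshoot_cost (R := R) (d := d))%:E *
      mean_exit_time P Y x U.
Proof.
move=> mphi phi0 phiL phiV.
set cost := overshoot_cost.
have rho0 : (0 < r / 8)%R by rewrite divr_gt0.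
have g_exists (p : nat * nat) : exists g : T -> R,
  [/\ measurable_fun setT g, (forall w, 0 <= g w)%R,
    (forall w s, (r / 2 <= enorm (trajectory Y x w (S p.1 p.2 w) - x))%R -> (s
        <= L%:R)%R ->
      (forall u v, S p.1 p.2 w <= u -> u < s -> S p.1 p.2 w <= v -> v < s ->
        enorm (W v w - W u w) < 8 * r)%R ->
      (s <= S p.1 p.2 w + g w)%R) &
    \int[P]_w (g w)%:E <= cost%:E * \int[P]_w (S p.1 p.2 w)%:E].
  case: p => n k /=.
  have bK := borel_shrink U n.
  have [g [mg g0 gs gi]] := overshoot_bound levyY d0 rho0 (mesh_gt0 k)
    (@grid_exit_index_lt _ _ _ _ Y x L k (shrink U n))
    (past_grid_exit_index Y x L k bK) (ler0n R L).
  exists g; split => //.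
    move=> w s; rewrite (_ : trajectory Y x w _ - x = W (S n k w) w)%R; last
        first.
      by rewrite /trajectory [X in (X - _)%R]addrC addrK.
    have -> : (r / 2 = 4 * (r / 8))%R by field.
    have -> : (8 * r = 64 * (r / 8))%R by field.
    exact: gs.
  by rewrite (integral_grid_exit levyY)// -EFinM.
have [g hg] := choice g_exists.
pose h n k w := (S n k w + g (n, k) w)%:E.
have mean_ge0 : 0 <= mean_exit_time P Y x U.
  by apply: integral_ge0 => w _; exact: exit_time_ge0.
have cost0 : (0 <= cost)%R by exact: overshoot_cost_ge0.
apply: (iterated_fatou (f := h)).
- exact/measurable_EFinP.
- by move=> w; rewrite lee_fin.
- move=> n k; apply/measurable_EFinP; apply: measurable_funD => //.
  by case: (hg (n, k)).
- move=> n k w; rewrite lee_fin addr_ge0//; first exact: grid_exit_ge0.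
  by case: (hg (n, k)).
- have noj := no_jump_at_limit levyY x L (fun n => borel_shrink U n).
  apply: filterS2 ae_regular noj => w [rc ll pathE] nojump e e0.
  pose t := sup (range (S' ^~ w)).
  have S'_sup : has_sup (range (S' ^~ w)).
    split; first by exists (S' 0%N w), 0%N.
    by exists L%:R => _ [n _ <-]; exact: limit_exit_le.
  have S't n : (S' n w <= t)%R.
    by apply: ub_le_sup; [case: S'_sup|exists n].
  have tS' u : (0 < u)%R -> \forall n \near \oo, (t - u < S' n w)%R.
    move=> u0; have [_ [n _ <-] tn] := sup_adherent u0 S'_sup.
    exists n => // m /= nm; apply: lt_le_trans tn _.
    exact: S'_nondecreasing.
  have [cvgt|jump] := @cvg_or_jump _ _ (trajectory Y x w) (fun n k => S n k w)
      (S' ^~ w) t rc ll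
    (fun n => limit_exit_ge0 _ _ _) (fun n k => limit_exit_le_grid _ _ _ _)
    (fun n u u0 => grid_exit_lt_near _ _ _ u0) S't (@S'_nondecreasing w) tS';
        last first.
    by case: (nojump jump).
  have Vphi u : (0 <= u)%R -> (u < phi w)%R -> V (trajectory Y x w u).
    by move=> u0 uphi; rewrite -pathE; exact: (exit_time_inside (phiV w)).
  have := @grid_exit_alternative _ _ (trajectory Y x w) U V x r L (phi w) e t rc
      openU r0 e0
    (fun z => eball_diff xr) S't tS' cvgt Vphi (phiL w).
  apply: filterS => n; apply: filterS => k.
  rewrite -EFinD lee_fin; case: (hg (n, k)) => /= _ g0 gs _ [phiS|far].
    by rewrite (le_trans phiS)// lerD2r lerDl.
  rewrite (@le_trans _ _ (S n k w + g (n, k) w)%R)// ?lerDl ?(ltW e0)//.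
  apply: gs => // u v Su uphi Sv vphi.
  have [_ Vu] : V (trajectory Y x w u).
    by apply: Vphi => //; apply: le_trans Su; exact: grid_exit_ge0.
  have [_ Vv] : V (trajectory Y x w v).
    by apply: Vphi => //; apply: le_trans Sv; exact: grid_exit_ge0.
  move: Vu Vv; rewrite /eball/= => Vu Vv.
  have := ler_enormD (trajectory Y x w v - z0) (z0 - trajectory Y x w u).
  rewrite addrA subrK -(enormN (z0 - _)) opprB.
  rewrite (_ : trajectory Y x w v - trajectory Y x w u = W v w - W u w)%R; last
      first.
    by rewrite /trajectory opprD addrACA subrr add0r.
  by lra.
move=> n; apply: (@le_trans _ _ ((1 + cost)%:E * \int[P]_w (S' n w)%:E)); last
    first.
  by apply: lee_wpmul2l => //; rewrite lee_fin addr_ge0.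
apply: (@limn_einf_le _ _ (fun k => (1 + cost)%:E * \int[P]_w (S n k w)%:E)).
  move=> k; case: (hg (n, k)) => /= mg g0 _ gi.
  under eq_integral do rewrite /h EFinD.
  rewrite ge0_integralD//; last 4 first.
  - by move=> w _; rewrite lee_fin grid_exit_ge0.
  - exact/measurable_EFinP.
  - by move=> w _; rewrite lee_fin.
  - exact/measurable_EFinP.
  by rewrite EFinD ge0_muleDl ?lee_fin// mul1e leeD.
by apply: cvgeZl => //; exact: integral_S_cvg.
Qed.

End main.

Theorem theorem2p9 (R : realType) (d : nat) (d_ge1 : (1 <= d)%N) :
  exists C : R, 1 < C /\
    forall (disp : measure_display) (T : measurableType disp)
      (P : probability T R) (Y : R -> T -> 'rV[R]_d),
    levy_process P Y ->
    forall D : set 'rV[R]_d, open D ->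
    forall z0 : 'rV[R]_d, boundary D z0 ->
    forall r : R, 0 < r ->
    forall x : 'rV[R]_d, (D `&` eball z0 r) x ->
    (mean_exit_time P Y x (D `&` eball z0 (4 * r)) <=
       C%:E * mean_exit_time P Y x (D `&` eball z0 (2 * r)))%E.
Proof.
exists (1 + overshoot_cost (R := R) (d := d)); split.
  rewrite ltrDl; apply: divr_gt0; first by rewrite !mulr_gt0// ltr0n.
  by rewrite exprn_gt0// invr_gt0 mulr_gt0// ltr0n.
move=> disp T P Y levyY D openD z0 _ r r0 x [_ xr].
apply: integral_le_bounded => [w|L phi mphi phi0 phiL phiV].
  exact: exit_time_ge0.
exact: (mean_exit_le levyY d_ge1 openD r0 xr mphi phi0 phiL phiV).
Qed.
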